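(* Let $0<d<n$ be integers. There exist $\varepsilon_0>0$ and $C\ge1$, depending only on $n$ and $d$, such that the following holds for $0<\varepsilon\le\varepsilon_0$. Let $E\subset\mathbb{R}^n$ and let $\Sigma_0\subset\mathbb{R}^n$ be an $\varepsilon$-flat model surface. Assume that $\mathrm{dist}(x,\Sigma_0)\le\varepsilon$ for $x\in E$, and that for each $x\in E$ and integer $k\ge0$ we are given an affine $d$-plane $P_k(x)$ through $x$ such that $$d_{x,100r_k}(P_k(x),P_k(x'))\le\varepsilon\ \text{ for }k\ge0\text{ and }x,x'\in E\text{ with }|x'-x|\le100r_k,$$ $$d_{x,r_k}(P_k(x),P_{k+1}(x))\le\varepsilon\ \text{ for }k\ge0\text{ and }x\in E,$$ $$d_{x,100}(P_0(x),P_y)\le\varepsilon\ \text{ for }x\in E\text{ and }y\in\Sigma_0\text{ with }|x-y|\le2,$$ where $P_y$ is the $d$-plane attached to $y\in\Sigma_0$ in the description of $\Sigma_0$. Then there is a bijective mapping $g:\mathbb{R}^n\to\mathbb{R}^n$ such that $$g(x)=x\ \text{ when }\mathrm{dist}(x,E)\ge12,$$ $$|g(x)-x|\le C\varepsilon\ \text{ for }x\in\mathbb{R}^n,$$ $$\tfrac14|x'-x|^{1+C\varepsilon}\le|g(x')-g(x)|\le3|x'-x|^{1-C\varepsilon}\ \text{ for }x,x'\in\mathbb{R}^n\text{ with }|x'-x|\le1,$$ and $E\subset g(\Sigma_0)$. In addition, $\Sigma=g(\Sigma_0)$ is Reifenberg-flat, in the sense that for $x\in\Sigma$ and $r\in(0,1]$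 there is an affine $d$-plane $Q(x,r)$ through $x$ such that $d_{x,r}(\Sigma,Q(x,r))\le C\varepsilon$.
   Context: $r_k=10^{-k}$. For sets $E,F$ that both meet $B(x,r)$, $d_{x,r}(E,F)=\frac1r\max\{\sup_{y\in E\cap B(x,r)}\mathrm{dist}(y,F),\ \sup_{y\in F\cap B(x,r)}\mathrm{dist}(y,E)\}$. An ''$\varepsilon$-flat model surface'' means a smooth $d$-dimensional manifold $\Sigma_0\subset\mathbb{R}^n$ such that for every $x\in\Sigma_0$ there are an affine $d$-plane $P_x$ through $x$ and a $C^2$ function $F_x:P_x\to P_x^\perp$ (where $P_x^\perp$ is the $(n-d)$-dimensional vector space orthogonal to $P_x$) such that $|F_x(y)|+|DF_x(y)|+|D^2F_x(y)|\le\varepsilon$ for $y\in P_x$, and $\Sigma_0\cap B(x,200)=\{y+F_x(y):y\in P_x\}\cap B(x,200)$. *)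

(* Defs.v *)
From mathcomp Require Import all_boot all_order all_algebra.
From mathcomp Require Import all_classical all_reals all_analysis.

Set Implicit Arguments.
Unset Strict Implicit.
Unset Printing Implicit Defensive.

Import Order.TTheory GRing.Theory Num.Theory.
Import numFieldNormedType.Exports.

Local Open Scope classical_set_scope.
Local Open Scope ring_scope.

(* The library norm `|v| on 'rV[R]_n is the sup norm, hence the explicit
   Euclidean norm; the topologies of the two norms agree. *)
Definition dotp (R : realType) (n : nat) (u v : 'rV[R]_n) : R :=
  \sum_(i < n) u 0 i * v 0 i.

Definition enorm (R : realType) (n : nat) (v : 'rV[R]_n) : R :=
  Num.sqrt (dotp v v).

Definition eball (R : realType) (n : nat) (x : 'rV[R]_n) (r : R) :
    set 'rV[R]_n :=
  [set y | enorm (y - x) <= r].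

(* Extended-real valued, so that the distance to the empty set is +oo. *)
Definition dist_set (R : realType) (n : nat) (x : 'rV[R]_n)
    (A : set 'rV[R]_n) : \bar R :=
  ereal_inf [set (enorm (x - y))%:E | y in A].

(* d_{x,r}(E,F). It is used only for sets that both meet the closed ball
   B(x,r), so neither supremum is over the empty set. *)
Definition local_hausdorff (R : realType) (n : nat) (x : 'rV[R]_n) (r : R)
    (E F : set 'rV[R]_n) : \bar R :=
  (r^-1%:E * maxe (ereal_sup [set dist_set y F | y in E `&` eball x r])
                  (ereal_sup [set dist_set y E | y in F `&` eball x r]))%E.

Definition plane (R : realType) (n : nat) (x : 'rV[R]_n)
    (V : {vspace 'rV[R]_n}) : set 'rV[R]_n :=
  [set y | y - x \in V].

Definition dplane_through (R : realType) (n d : nat) (x : 'rV[R]_n)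
    (P : set 'rV[R]_n) : Prop :=
  exists V : {vspace 'rV[R]_n}, \dim V = d /\ P = plane x V.

(* D_{v_1} (D_{v_2} (... (D_{v_k} f))) for vs = [:: v_1; ...; v_k]. *)
Definition iter_derive (R : realType) (n m : nat) (vs : seq 'rV[R]_n)
    (f : 'rV[R]_n -> 'rV[R]_m) : 'rV[R]_n -> 'rV[R]_m :=
  foldr (fun v g => fun x => 'D_v g x) f vs.

(* f restricted to S is of class C^k, where S is relatively open in an affine
   plane of direction V: the iterated directional derivatives of order at most
   k along V exist and are continuous on S. At points of S they depend only on
   the values of f on S, so the values of f elsewhere play no role. *)
Definition class_C (R : realType) (n m k : nat) (V : {vspace 'rV[R]_n})
    (S : set 'rV[R]_n) (f : 'rV[R]_n -> 'rV[R]_m) : Prop :=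
  forall vs : seq 'rV[R]_n, {in vs, forall v, v \in V} -> (size vs <= k)%N ->
    {within S, continuous (iter_derive vs f)} /\
    ((size vs < k)%N -> forall y v, S y -> v \in V ->
       derivable (iter_derive vs f) y v).

Definition smooth_on (R : realType) (n m : nat) (U : set 'rV[R]_n)
    (f : 'rV[R]_n -> 'rV[R]_m) : Prop :=
  forall k : nat, class_C k fullv U f.

(* Norm of the k-th derivative of f at y, as a k-linear map on V. *)
Definition deriv_norm (R : realType) (n m k : nat) (V : {vspace 'rV[R]_n})
    (f : 'rV[R]_n -> 'rV[R]_m) (y : 'rV[R]_n) : \bar R :=
  ereal_sup [set (enorm (iter_derive vs f y))%:E | vs in
    [set vs : seq 'rV[R]_n | size vs = k /\
       {in vs, forall v, v \in V /\ enorm v <= 1}]].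

(* Embedded smooth submanifolds, through slice charts: near each point a
   diffeomorphism phi onto an open set maps Sigma to the coordinate d-plane
   {z | z_i = 0 for i >= d}. *)
Definition smooth_submanifold (R : realType) (n d : nat)
    (Sigma : set 'rV[R]_n) : Prop :=
  forall x, Sigma x ->
    exists (U : set 'rV[R]_n) (phi psi : 'rV[R]_n -> 'rV[R]_n),
      [/\ open U, U x & open (phi @` U)] /\
      [/\ smooth_on U phi, smooth_on (phi @` U) psi,
          forall y, U y -> psi (phi y) = y
        & forall y, U y ->
            (Sigma y <-> forall i : 'I_n, (d <= i)%N -> phi y 0 i = 0)].

(* PS x is the plane attached to x \in Sigma. *)
Definition flat_model_surface (R : realType) (n d : nat) (eps : R)
    (Sigma : set 'rV[R]_n) (PS : 'rV[R]_n -> set 'rV[R]_n) : Prop :=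
  smooth_submanifold d Sigma /\
  forall x, Sigma x ->
    exists (V : {vspace 'rV[R]_n}) (F : 'rV[R]_n -> 'rV[R]_n),
      [/\ \dim V = d, PS x = plane x V & class_C 2 V (PS x) F] /\
      [/\ forall y, PS x y -> forall v, v \in V -> dotp (F y) v = 0,
          forall y, PS x y ->
            ((enorm (F y))%:E + deriv_norm 1 V F y + deriv_norm 2 V F y
               <= eps%:E)%E
        & Sigma `&` eball x 200 = [set y + F y | y in PS x] `&` eball x 200].

Definition scale10 (R : realType) (k : nat) : R := 10 ^- k.

Definition reifenberg_flat (R : realType) (n d : nat) (delta : R)
    (Sigma : set 'rV[R]_n) : Prop :=
  forall x r, Sigma x -> 0 < r <= 1 ->
    exists Q : set 'rV[R]_n,
      dplane_through d x Q /\ (local_hausdorff x r Sigma Q <= delta%:E)%E.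

(* Main.v *)
Require Import Defs.
From mathcomp Require Import all_boot all_order all_algebra.
From mathcomp Require Import all_classical all_reals all_analysis.
From mathcomp Require Import ring lra.

Import Order.TTheory GRing.Theory Num.Theory.
Import numFieldNormedType.Exports.

Local Open Scope classical_set_scope.
Local Open Scope ring_scope.

(* With r_k = 10^-k, the map g is a limit of compositions f_(k+1) = sigma_k o f_k
   in which each sigma_k - id is defined on all of R^n, is O(eps)-Lipschitz, is
   bounded by O(eps) r_k, and vanishes at distance >= 6 r_k from E. Such a limit
   is automatically a bi-Hoelder bijection: follow two points up to the first k
   at which their distance is at least r_k; later maps move them much less.

   Let S_k = f_k(Sigma0). On S_k near E, sigma_k is a map q_k that is O(eps)-close
   in the Lipschitz sense, at scale r_k, to the affine projection on P_k(x) for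
   every x in E at once; McShane's extension theorem gives sigma_k elsewhere.
   Since q_k almost factors through that projection, S_(k+1) is near x a graph
   over P_k(x) whose Lipschitz constant does not depend on the constant for S_k,
   so that S_k is O(eps)-flat near E at scale r_k uniformly in k. *)

(** * Euclidean norm *)

(** The constants are chosen so that the construction reproduces its own hypothesis. [c] measures
    how far the glued projection is from each affine projection. The slope and the offset from E of
    the next surface are bounded through [c], so one [alpha] of order n^2 eps serves at every stage.
    [lam] then bounds sigma_k - id, both in size and in Lipschitz constant; its leading factor n is
    the price of extending vector-valued maps one coordinate at a time. Planes are represented by
    orthogonal projections and surfaces by sets that are Lipschitz graphs over them. Derivatives
    occur only once, to bound the slope of the model surface; afterwards closeness, covering and
    closedness are metric statements about graphs. The planes P_k(x) give information only near E,
    whereas Reifenberg flatness is claimed on the whole limit surface. At a point and scale far from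
    E the surface has stopped moving, so it coincides there with an earlier stage: either the model
    surface, or the image under one more near-identity map of a stage that was still controlled by a
    plane. One such map adds O(eps) to the slope, which is harmless because it happens only once. *)

Section Euclidean.
Context {R : realType} {n : nat}.
Implicit Types (u v w : 'rV[R]_n) (a c : R).

Lemma coordB u v i : (u - v) 0 i = u 0 i - v 0 i.
Proof. by rewrite !mxE. Qed.

Lemma dotpE u v : dotp u v = (u *m v^T) 0 0.
Proof. by rewrite mxE; apply: eq_bigr => i _; rewrite mxE. Qed.

Lemma dotpC u v : dotp u v = dotp v u.
Proof. by apply: eq_bigr => i _; rewrite mulrC. Qed.

Lemma dotpDl u v w : dotp (u + v) w = dotp u w + dotp v w.
Proof. by rewrite !dotpE mulmxDl mxE. Qed.

Lemma dotpZl a u w : dotp (a *: u) w = a * dotp u w.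
Proof. by rewrite !dotpE -scalemxAl mxE. Qed.

Lemma dotpNl u w : dotp (- u) w = - dotp u w.
Proof. by rewrite -scaleN1r dotpZl mulN1r. Qed.

Lemma dotpBl u v w : dotp (u - v) w = dotp u w - dotp v w.
Proof. by rewrite dotpDl dotpNl. Qed.

Lemma dotpDr u v w : dotp w (u + v) = dotp w u + dotp w v.
Proof. by rewrite dotpC dotpDl !(dotpC w). Qed.

Lemma dotpZr a u w : dotp w (a *: u) = a * dotp w u.
Proof. by rewrite dotpC dotpZl dotpC. Qed.

Lemma dotpBr u v w : dotp w (u - v) = dotp w u - dotp w v.
Proof. by rewrite dotpC dotpBl !(dotpC w). Qed.

Lemma dotp_ge0 u : 0 <= dotp u u.
Proof. by apply: sumr_ge0 => i _; rewrite -expr2 sqr_ge0. Qed.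

Lemma sqr_enorm u : enorm u ^+ 2 = dotp u u.
Proof. by rewrite sqr_sqrtr // dotp_ge0. Qed.

Lemma enorm_ge0 u : 0 <= enorm u.
Proof. exact: sqrtr_ge0. Qed.
Hint Resolve enorm_ge0 : core.

Lemma enormZ a u : enorm (a *: u) = `|a| * enorm u.
Proof.
by rewrite /enorm dotpZl dotpZr mulrA -expr2 sqrtrM ?sqr_ge0 // sqrtr_sqr.
Qed.

Lemma enormN u : enorm (- u) = enorm u.
Proof. by rewrite -scaleN1r enormZ normrN1 mul1r. Qed.

Lemma enorm0 : enorm (0 : 'rV[R]_n) = 0.
Proof. by rewrite -(scale0r 0) enormZ normr0 mul0r. Qed.

Lemma enorm_coord u i : `|u 0 i| <= enorm u.
Proof.
rewrite -sqrtr_sqr ler_wsqrtr // /dotp (bigD1 i) //= -expr2 lerDl.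
by apply: sumr_ge0 => j _; rewrite -expr2 sqr_ge0.
Qed.

Lemma enorm0_eq0 u : enorm u <= 0 -> u = 0.
Proof.
move=> u0; apply/rowP => i; rewrite mxE; apply/eqP; rewrite -normr_le0.
exact: le_trans (enorm_coord u i) u0.
Qed.

Lemma cauchy_schwarz u v : dotp u v <= enorm u * enorm v.
Proof.
have [u0|u_gt0] := leP (enorm u) 0.
  by rewrite (enorm0_eq0 _ u0) enorm0 mul0r -(scale0r 0) dotpZl mul0r.
have [v0|v_gt0] := leP (enorm v) 0.
  by rewrite (enorm0_eq0 _ v0) enorm0 mulr0 -(scale0r 0) dotpZr mul0r.
have := dotp_ge0 (enorm v *: u - enorm u *: v).
rewrite dotpBl !dotpBr !dotpZl !dotpZr -!sqr_enorm (dotpC v u).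
set a := enorm u; set b := enorm v; set s := dotp u v => H.
have : 0 <= (2 * a * b) * (a * b - s) by lra.
by rewrite pmulr_rge0 ?subr_ge0 // !mulr_gt0.
Qed.

Lemma enormD u v : enorm (u + v) <= enorm u + enorm v.
Proof.
rewrite -(@ler_pXn2r _ 2) ?nnegrE ?addr_ge0 //.
rewrite sqr_enorm dotpDl !dotpDr -!sqr_enorm (dotpC v u) sqrrD.
have := cauchy_schwarz u v; lra.
Qed.

Lemma enormB u v : enorm (u - v) <= enorm u + enorm v.
Proof. by rewrite -(enormN v) enormD. Qed.

Lemma enorm_distC u v : enorm (u - v) = enorm (v - u).
Proof. by rewrite -opprB enormN. Qed.

Lemma enorm_dist_tri v u w : enorm (u - w) <= enorm (u - v) + enorm (v - w).
Proof. by rewrite -{1}(subrK v u) -addrA enormD. Qed.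

Lemma enorm_le_coord u c : (forall i, `|u 0 i| <= c) -> enorm u <= n%:R * c.
Proof.
move=> uc; have [->|n0] := eqVneq u 0.
  rewrite enorm0; case: (posnP n) => [->|n_gt0]; first by rewrite mul0r.
  by rewrite mulr_ge0 // (le_trans _ (uc (Ordinal n_gt0))).
have c0 : 0 <= c.
  have /rV0Pn[i _] := n0; exact: le_trans (uc i).
rewrite -(@ler_pXn2r _ 2) ?nnegrE ?mulr_ge0 // sqr_enorm.
apply: (@le_trans _ _ (\sum_(i < n) c ^+ 2)).
  apply: ler_sum => i _; rewrite -expr2 -real_normK ?num_real //.
  by rewrite ler_pXn2r ?nnegrE.
rewrite sumr_const card_ord exprMn -[c ^+ 2 *+ n]mulr_natl ler_wpM2r ?sqr_ge0 //.
by rewrite -natrX ler_nat; case: n => // m; rewrite expnS leq_pmulr // expn_gt0.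
Qed.

End Euclidean.
#[global] Hint Resolve enorm_ge0 : core.

(** * Geometric limits and Lipschitz extension *)

Section Completeness.
Context {R : realType}.

(** Stands in for passing to the limit, since convergence is always expressed by explicit geometric
    bounds. If [a] were positive, 2^m would outgrow [c / a], while [q ^+ m] is at most 2^-m. *)
Lemma le_geometric_le0 (a c q : R) : 0 <= q <= 2^-1 ->
  (forall k, a <= c * q ^+ k) -> a <= 0.
Proof.
move=> /andP[q0 q2] ac; rewrite leNgt; apply/negP => a0.
have c0 : 0 < c by have := ac 0%N; rewrite expr0 mulr1; exact: lt_le_trans.
have := archi_boundP (ltW (divr_gt0 c0 a0)); set m := Num.Def.archi_bound _.
rewrite ltr_pdivrMr // => cm.
have m2 : m%:R <= (2 : R) ^+ m by rewrite -natrX ler_nat ltnW // ltn_expl.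
have qm : q ^+ m <= 2^-1 ^+ m by rewrite lerXn2r // nnegrE // invr_ge0.
have : c * q ^+ m < a.
  apply: (@le_lt_trans _ _ (c * 2^-1 ^+ m)); first by rewrite ler_pM2l.
  rewrite exprVn ltr_pdivrMr ?exprn_gt0 //.
  by apply: lt_le_trans cm _; rewrite mulrC ler_pM2l.
by rewrite ltNge ac.
Qed.

(** As [q] is at most 1/2, the radii [e k] drop by at least [c * q ^+ k] at each step. The intervals
    of radius [e k] about [u k] are therefore nested, and the limit is the supremum of their left
    ends. *)
Lemma geometric_limit_real (u : nat -> R) (c q : R) :
  0 <= q <= 2^-1 -> (forall k, `|u k.+1 - u k| <= c * q ^+ k) ->
  exists l, forall k, `|l - u k| <= 2 * c * q ^+ k.
Proof.
move=> /andP[q0 q2] uc.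
have c0 : 0 <= c by have := uc 0%N; rewrite expr0 mulr1; exact: le_trans.
pose e k := 2 * c * q ^+ k.
have e_ge0 k : 0 <= e k by rewrite /e !mulr_ge0 // exprn_ge0.
have eS k : `|u k.+1 - u k| <= e k - e k.+1.
  apply: le_trans (uc k) _; rewrite /e exprSr.
  have : 0 <= c * q ^+ k by rewrite mulr_ge0 // exprn_ge0.
  set t := c * q ^+ k => t0.
  have -> : 2 * c * q ^+ k - 2 * c * (q ^+ k * q) = t * (2 - 2 * q).
    by rewrite /t; ring.
  by rewrite ler_peMr //; lra.
have eD k j : `|u (k + j)%N - u k| <= e k - e (k + j)%N.
  elim: j => [|j IH]; first by rewrite addn0 !subrr normr0.
  rewrite addnS; have := eS (k + j)%N; move: IH.
  rewrite !ler_norml; lra.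
have lowup j k : u j - e j <= u k + e k.
  have [jk|/ltnW kj] := leqP j k.
    have := eD j (k - j)%N; rewrite subnKC // ler_norml.
    have := e_ge0 k; lra.
  have := eD k (j - k)%N; rewrite subnKC // ler_norml.
  have := e_ge0 j; lra.
pose A := [set u j - e j | j in [set: nat]].
exists (sup A) => k; rewrite ler_norml; apply/andP; split.
- have : u k - e k <= sup A.
    apply: ub_le_sup; last by exists k.
    by exists (u 0%N + e 0%N) => _ [j _ <-].
  rewrite /e; lra.
- have : sup A <= u k + e k.
    by apply: ge_sup; [exists (u 0%N - e 0%N); exists 0%N|move=> _ [j _ <-]].
  rewrite /e; lra.
Qed.

Context {n : nat}.
Implicit Types u v w : 'rV[R]_n.

Lemma geometric_limit (u : nat -> 'rV[R]_n) (c q : R) :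
  0 <= q <= 2^-1 -> (forall k, enorm (u k.+1 - u k) <= c * q ^+ k) ->
  exists l, forall k, enorm (l - u k) <= n%:R * (2 * c * q ^+ k).
Proof.
move=> q2 uc.
have /choice[l hl] : forall i : 'I_n, exists l, forall k,
    `|l - u k 0 i| <= 2 * c * q ^+ k.
  move=> i; apply: geometric_limit_real q2 _ => k.
  have := enorm_coord (u k.+1 - u k) i; rewrite !mxE => h.
  exact: le_trans h (uc k).
exists (\row_i l i) => k; apply: enorm_le_coord => i.
by rewrite !mxE.
Qed.

(** Banach iteration of [u => y - h u]. It gives the surjectivity of near-identity maps, and also
    that deformed or tilted graphs still project onto the whole plane. *)
Lemma id_plus_contraction_surj (h : 'rV[R]_n -> 'rV[R]_n) :
  (forall y y', enorm (h y - h y') <= 2^-1 * enorm (y - y')) ->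
  forall y, exists u, u + h u = y.
Proof.
move=> hL y; pose u k := iter k (fun u => y - h u) y.
have uS k : u k.+1 = y - h (u k) by [].
have half : 0 <= (2^-1 : R) <= 2^-1 by lra.
set c := enorm (u 1%N - u 0%N).
have uc k : enorm (u k.+1 - u k) <= c * 2^-1 ^+ k.
  elim: k => [|k IH]; first by rewrite expr0 mulr1.
  rewrite uS {2}uS opprB addrC addrA subrK enorm_distC.
  apply: le_trans (hL _ _) _; rewrite exprS; lra.
have [l hl] := geometric_limit u c _ half uc.
exists l; apply/eqP; rewrite -subr_eq0; apply/eqP/enorm0_eq0.
apply: (@le_geometric_le0 _ (n%:R * (2 * c)) _ half) => k.
have -> : l + h l - y = (l - u k.+1) + (h l - h (u k)).
  by rewrite uS; apply/rowP => i; rewrite !mxE; ring.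
apply: le_trans (enormD _ _) _.
have := hl k.+1; have := le_trans (hL l (u k)) (ler_wpM2l _ (hl k)).
rewrite exprS; lra.
Qed.

End Completeness.

Section McShane.
Context {R : realType} {n : nat}.
Implicit Types (A : set 'rV[R]_n) (u v w : 'rV[R]_n).

Definition inf_over A (f : 'rV[R]_n -> R) : R := inf [set f z | z in A].

Lemma inf_over_le {A f} b {z} : (forall z, A z -> b <= f z) -> A z ->
  inf_over A f <= f z.
Proof.
move=> bf Az; apply: ge_inf; last by exists z.
by exists b => _ [w Aw <-]; apply: bf.
Qed.

Lemma le_inf_over {A f b z} : A z -> (forall z, A z -> b <= f z) ->
  b <= inf_over A f.
Proof.
move=> Az bf; apply: lb_le_inf; first by exists (f z); exists z.
by move=> _ [w Aw <-]; apply: bf.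
Qed.

(** The extension is the infimum over [z] in [A] of [h z + L * enorm (y - z)]. A fixed [z0] in [A]
    provides the lower bound that makes this infimum meaningful, hence the separate case of an empty
    [A]. *)
Lemma mcshane_real A (h : 'rV[R]_n -> R) (L : R) : 0 <= L ->
  (forall y y', A y -> A y' -> `|h y - h y'| <= L * enorm (y - y')) ->
  exists H : 'rV[R]_n -> R, (forall y, A y -> H y = h y) /\
    forall y y', `|H y - H y'| <= L * enorm (y - y').
Proof.
move=> L0 hL.
have [[z0 Az0]|nA] := pselect (exists z, A z); last first.
  exists (fun=> 0); split=> [y Ay|y y']; first by case: nA; exists y.
  by rewrite subrr normr0 mulr_ge0 // enorm_ge0.
pose f y z := h z + L * enorm (y - z).
have fL y y' z : f y z <= f y' z + L * enorm (y - y').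
  by have := ler_wpM2l L0 (enorm_dist_tri y' y z); rewrite /f; lra.
have lb y z : A z -> h z0 - L * enorm (y - z0) <= f y z.
  move=> Az; have := hL z0 z Az0 Az; rewrite ler_norml => /andP[_].
  have := ler_wpM2l L0 (enorm_dist_tri y z0 z); rewrite (enorm_distC z0 y) /f.
  lra.
have HL y y' : inf_over A (f y) - L * enorm (y - y') <= inf_over A (f y').
  apply: (le_inf_over Az0) => z Az.
  have := inf_over_le _ (lb y) Az; have := fL y y' z; lra.
exists (fun y => inf_over A (f y)); split=> [y Ay|y y'].
  apply/eqP; rewrite eq_le; apply/andP; split.
    have := inf_over_le _ (lb y) Ay.
    by rewrite {2}/f subrr enorm0 mulr0 addr0.
  apply: (le_inf_over Az0) => z Az; have := hL y z Ay Az.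
  rewrite ler_norml /f; lra.
rewrite ler_norml; have := HL y y'; have := HL y' y.
rewrite (enorm_distC y' y); lra.
Qed.

Lemma mcshane A (h : 'rV[R]_n -> 'rV[R]_n) (L : R) : 0 <= L ->
  (forall y y', A y -> A y' -> enorm (h y - h y') <= L * enorm (y - y')) ->
  exists H : 'rV[R]_n -> 'rV[R]_n, (forall y, A y -> H y = h y) /\
    forall y y', enorm (H y - H y') <= n%:R * L * enorm (y - y').
Proof.
move=> L0 hL.
have /choice[H hH] : forall i : 'I_n, exists H : 'rV[R]_n -> R,
    (forall y, A y -> H y = h y 0 i) /\
    forall y y', `|H y - H y'| <= L * enorm (y - y').
  move=> i; apply: mcshane_real => // y y' Ay Ay'.
  have := enorm_coord (h y - h y') i; rewrite !mxE => /le_trans; apply.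
  exact: hL.
exists (fun y => \row_i H i y); split=> [y Ay|y y'].
  by apply/rowP => i; rewrite mxE (hH i).1.
by rewrite -mulrA; apply: enorm_le_coord => i; rewrite !mxE; apply: (hH i).2.
Qed.

End McShane.

(** * Lipschitz graphs over a subspace *)

Ltac vring := apply/rowP => ?; rewrite !mxE; ring.

Section Graphs.
Context {R : realType} {n : nat}.
Implicit Types (p : 'rV[R]_n -> 'rV[R]_n) (G : set 'rV[R]_n).
Implicit Types (u v w x y z : 'rV[R]_n).

(** Linear, idempotent and self-adjoint maps stand for subspaces, so that the angle between two of
    them becomes an operator bound on [p u - p' u]. *)
Definition orth_proj p :=
  [/\ forall a u v, p (a *: u + v) = a *: p u + p v, forall u, p (p u) = p u &
      forall u v, dotp (p u) v = dotp u (p v)].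

Lemma orth_projD p u v : orth_proj p -> p (u + v) = p u + p v.
Proof. by case=> h _ _; rewrite -{1}[u]scale1r h scale1r. Qed.

Lemma orth_projB p u v : orth_proj p -> p (u - v) = p u - p v.
Proof. by case=> h _ _; rewrite addrC -scaleN1r h scaleN1r addrC. Qed.

Lemma orth_proj0 p : orth_proj p -> p 0 = 0.
Proof. by move=> op; rewrite -{1}(subrr 0) orth_projB // subrr. Qed.

Lemma orth_projZ p a u : orth_proj p -> p (a *: u) = a *: p u.
Proof.
by move=> op; have [h _ _] := op; rewrite -[a *: u]addr0 h orth_proj0 // addr0.
Qed.

Lemma orth_projK p u : orth_proj p -> p (p u) = p u.
Proof. by case. Qed.

Lemma orth_proj_pythagoras p u : orth_proj p ->
  enorm u ^+ 2 = enorm (p u) ^+ 2 + enorm (u - p u) ^+ 2.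
Proof.
move=> [_ pp pT]; rewrite !sqr_enorm dotpBl !dotpBr.
have -> : dotp (p u) (p u) = dotp u (p u) by rewrite pT pp.
by rewrite (dotpC (p u) u); ring.
Qed.

Lemma enorm_proj p u : orth_proj p -> enorm (p u) <= enorm u.
Proof.
move=> op; rewrite -(@ler_pXn2r _ 2) ?nnegrE ?enorm_ge0 //.
by rewrite (orth_proj_pythagoras p u op) lerDl sqr_ge0.
Qed.

Lemma enorm_coproj p u : orth_proj p -> enorm (u - p u) <= enorm u.
Proof.
move=> op; rewrite -(@ler_pXn2r _ 2) ?nnegrE ?enorm_ge0 //.
by rewrite (orth_proj_pythagoras p u op) lerDr sqr_ge0.
Qed.

(** Split [p u - p' u] into [p u - p' (p u)], controlled by the first gap, and [t = p' w] with
    [w = u - p u] orthogonal to the range of [p]. For the latter, [enorm t ^+ 2 = dotp w (t - p t)],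
    and the second gap bounds [t - p t]. *)
Lemma orth_proj_close p p' (eta : R) : orth_proj p -> orth_proj p' ->
  (forall u, enorm (p u - p' (p u)) <= eta * enorm u) ->
  (forall u, enorm (p' u - p (p' u)) <= eta * enorm u) ->
  forall u, enorm (p u - p' u) <= 2 * eta * enorm u.
Proof.
move=> op op' h1 h2 u.
set w := u - p u; set t := p' w.
have -> : p u - p' u = (p u - p' (p u)) - t.
  by rewrite /t /w (orth_projB p') //; vring.
have tt : enorm t ^+ 2 <= eta * enorm w * enorm t.
  have tE : p' t = t by rewrite /t orth_projK.
  have -> : enorm t ^+ 2 = dotp w (t - p t).
    have [_ _ pT] := op; have [_ _ pT'] := op'.
    rewrite dotpBr -pT /w (orth_projB p) // (orth_projK p) // subrr -/w.
    by rewrite sqr_enorm -(scale0r 0) dotpZl mul0r subr0 {1}/t pT' tE.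
  apply: le_trans (cauchy_schwarz _ _) _.
  have := h2 t; rewrite tE => /(ler_wpM2l (enorm_ge0 w)); lra.
have wu : enorm w <= enorm u by apply: enorm_coproj.
have et : enorm t <= eta * enorm u.
  have [t0|t0] := leP (enorm t) 0.
    apply: le_trans t0 _; exact: le_trans (enorm_ge0 _) (h1 u).
  have : enorm t <= eta * enorm w by rewrite -(ler_pM2r t0) -expr2.
  have [e0|e0] := leP 0 eta; first by have := ler_wpM2l e0 wu; lra.
  have := mulr_le0_ge0 (ltW e0) (enorm_ge0 w); have := enorm_ge0 t; lra.
apply: le_trans (enormB _ _) _; have := h1 u; lra.
Qed.

(** The vertical part is compared with the full chord rather than with its projection, so that
    perturbations simply add up. The second clause makes the graph an entire one, over the whole
    range of [p]. *)
Definition lip_graph p (delta : R) G :=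
  (forall z z', G z -> G z' ->
    enorm ((z - z') - p (z - z')) <= delta * enorm (z - z')) /\
  forall v, exists z, G z /\ p z = p v.

Lemma lip_graph_weaken {p delta} delta' {G} : delta <= delta' ->
  lip_graph p delta G -> lip_graph p delta' G.
Proof.
move=> dd [h1 h2]; split=> // z z' Gz Gz'; apply: le_trans (h1 _ _ Gz Gz') _.
by rewrite ler_wpM2r // enorm_ge0.
Qed.

Lemma lip_graph_dist {p delta G z z'} : orth_proj p -> delta <= 2^-1 ->
  lip_graph p delta G -> G z -> G z' -> enorm (z - z') <= 2 * enorm (p z - p z').
Proof.
move=> op d2 [h1 _] Gz Gz'; have := h1 _ _ Gz Gz'.
have := ler_wpM2r (enorm_ge0 (z - z')) d2.
have := enormD ((z - z') - p (z - z')) (p (z - z')); rewrite subrK.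
rewrite -(orth_projB p) //; lra.
Qed.

Lemma lip_graph_inj {p delta G z z'} : orth_proj p -> delta <= 2^-1 ->
  lip_graph p delta G -> G z -> G z' -> p z = p z' -> z = z'.
Proof.
move=> op d2 gG Gz Gz' zz'; apply/eqP; rewrite -subr_eq0; apply/eqP/enorm0_eq0.
have := lip_graph_dist op d2 gG Gz Gz'.
by rewrite zz' subrr enorm0 mulr0.
Qed.

(** The only candidate is the point [z'] of [G] above [p y]: if [z] in [G] is within [e / 3] of [y],
    then [z] is within [2 * e / 3] of [z']. *)
Lemma lip_graph_closed p delta G y : orth_proj p -> delta <= 2^-1 ->
  lip_graph p delta G ->
  (forall e, 0 < e -> exists z, G z /\ enorm (y - z) <= e) -> G y.
Proof.
move=> op d2 gG yG; have [z' [Gz' z'p]] := gG.2 y.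
suff -> : y = z' by [].
apply/eqP; rewrite -subr_eq0; apply/eqP/enorm0_eq0.
apply/ler_addgt0Pl => e e0; rewrite addr0.
have e3 : 0 < e / 3 by rewrite divr_gt0.
have [z [Gz yz]] := yG _ e3.
have := lip_graph_dist op d2 gG Gz Gz'.
rewrite z'p -(orth_projB p) //; have := enorm_proj p (z - y) op.
have := enorm_dist_tri z y z'; rewrite (enorm_distC z y); lra.
Qed.

Lemma lip_graph_section {p delta G} : orth_proj p -> delta <= 2^-1 ->
  lip_graph p delta G ->
  exists s : 'rV[R]_n -> 'rV[R]_n, [/\ forall v, G (s v),
    forall v, p (s v) = p v &
    forall v v', enorm (s v - s v') <= 2 * enorm (v - v')].
Proof.
move=> op d2 gG; have /choice[s sP] := gG.2.
exists s; split=> [v|v|v v']; [by case: (sP v)|by case: (sP v)|].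
have := lip_graph_dist op d2 gG (sP v).1 (sP v').1.
rewrite (sP v).2 (sP v').2 -(orth_projB p) //.
have := enorm_proj p (v - v') op; lra.
Qed.

Definition near_id (lam : R) (sigma : 'rV[R]_n -> 'rV[R]_n) :=
  forall y y', enorm ((sigma y - y) - (sigma y' - y')) <= lam * enorm (y - y').

Lemma near_id_ge {lam sigma} y y' : near_id lam sigma ->
  (1 - lam) * enorm (y - y') <= enorm (sigma y - sigma y').
Proof.
move=> /(_ y y') h; have := enormB (sigma y - sigma y')
  ((sigma y - y) - (sigma y' - y')).
have -> : sigma y - sigma y' - (sigma y - y - (sigma y' - y')) = y - y'.
  by vring.
lra.
Qed.

Lemma near_id_le {lam sigma} y y' : near_id lam sigma ->
  enorm (sigma y - sigma y') <= (1 + lam) * enorm (y - y').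
Proof.
move=> /(_ y y') h; have := enormD (y - y') ((sigma y - y) - (sigma y' - y')).
have -> : y - y' + (sigma y - y - (sigma y' - y')) = sigma y - sigma y'.
  by vring.
lra.
Qed.

(** A chord gains at most [lam] times its length in the vertical direction and shrinks by a factor
    of at most 2, hence the slope. For covering, [u => p (sigma (s u) - s u)] is a contraction, as
    [lam] is at most 1/4 and the section [s] is 2-Lipschitz. *)
Lemma lip_graph_image {p delta lam G sigma} : orth_proj p ->
  0 <= delta <= 2^-1 -> 0 <= lam <= 4^-1 -> lip_graph p delta G ->
  near_id lam sigma -> lip_graph p (2 * (delta + lam)) (sigma @` G).
Proof.
move=> op /andP[d0 d2] /andP[l0 l4] gG sL; split.
  move=> _ _ [y Gy <-] [y' Gy' <-].
  have := sL y y'; have := near_id_ge y y' sL; have := gG.1 _ _ Gy Gy'.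
  have -> : sigma y - sigma y' = (y - y') + ((sigma y - y) - (sigma y' - y')).
    by vring.
  set u := y - y'; set w := _ - (sigma y' - y') => h1 h2 h3.
  have -> : u + w - p (u + w) = (u - p u) + (w - p w).
    by rewrite (orth_projD p) //; vring.
  apply: le_trans (enormD _ _) _.
  have hw := le_trans (enorm_coproj p w op) h3.
  have u2 : enorm u <= 2 * enorm (u + w).
    have := ler_wpM2r (enorm_ge0 u) l4; have := enorm_ge0 u; lra.
  have := ler_wpM2l (addr_ge0 d0 l0) u2; lra.
move=> v; have [s [sG sp sL2]] := lip_graph_section op d2 gG.
pose h u := p (sigma (s u) - s u).
have hL y y' : enorm (h y - h y') <= 2^-1 * enorm (y - y').
  rewrite /h -(orth_projB p) //; apply: le_trans (enorm_proj _ _ op) _.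
  apply: le_trans (sL _ _) _.
  have := ler_wpM2r (enorm_ge0 (s y - s y')) l4; have := sL2 y y'; lra.
have [u hu] := id_plus_contraction_surj h hL v.
exists (sigma (s u)); split; first by exists (s u).
rewrite -hu /h (orth_projD p) // (orth_projK p) // -(sp u) -(orth_projD p) //.
by congr (p _); rewrite addrC subrK.
Qed.

Lemma lip_graph_tilt {p p' delta} eta {G} : orth_proj p -> orth_proj p' ->
  delta <= 2^-1 -> eta <= 4^-1 ->
  (forall u, enorm (p u - p' u) <= eta * enorm u) ->
  lip_graph p delta G -> lip_graph p' (delta + eta) G.
Proof.
move=> op op' d2 e4 pp' gG; split.
  move=> z z' Gz Gz'; have := gG.1 _ _ Gz Gz'; have := pp' (z - z').
  have := enormD (z - z' - p (z - z')) (p (z - z') - p' (z - z')).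
  rewrite addrA subrK; lra.
move=> w; have [s [sG sp sL2]] := lip_graph_section op d2 gG.
pose h u := p' (s u) - p (s u).
have hL y y' : enorm (h y - h y') <= 2^-1 * enorm (y - y').
  have -> : h y - h y' = - (p (s y - s y') - p' (s y - s y')).
    by rewrite /h (orth_projB p) // (orth_projB p') //; vring.
  rewrite enormN; apply: le_trans (pp' _) _.
  have := ler_wpM2r (enorm_ge0 (s y - s y')) e4; have := sL2 y y'; lra.
have [u hu] := id_plus_contraction_surj h hL (p' w).
exists (s u); split; first exact: sG.
(* [q] measures the failure of [s u] to lie above [p' w]. It lies in the range of [p'] and is killed
   by [p], so the closeness of [p] and [p'] gives [enorm q <= eta * enorm q], which forces
   [q = 0]. *)
set q := u - p u.
have qE : q = p' (w - s u).
  by rewrite (orth_projB p') // -hu /q /h sp; vring.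
have qp : p q = 0 by rewrite /q (orth_projB p) // (orth_projK p) // subrr.
have qp' : p' q = q by rewrite qE orth_projK.
have q0 : q = 0.
  apply: enorm0_eq0; have := pp' q; rewrite qp qp' sub0r enormN.
  have := ler_wpM2r (enorm_ge0 q) e4; have := enorm_ge0 q; lra.
by apply/eqP; rewrite eq_sym -subr_eq0 -(orth_projB p') // -qE q0.
Qed.

(* The new Lipschitz constant depends only on the local one, not on the
   constant [delta] of the whole graph. *)
Lemma lip_graph_localize {p delta} delta' {G x} z0 s : orth_proj p ->
  0 <= delta <= 4^-1 -> 0 <= delta' -> lip_graph p delta G ->
  G z0 -> enorm (z0 - x) <= s / 8 ->
  (forall z z', G z -> G z' -> enorm (z - x) <= s -> enorm (z' - x) <= s ->
    enorm ((z - z') - p (z - z')) <= delta' * enorm (z - z')) ->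
  exists G', lip_graph p (2 * n%:R * delta') G' /\
    forall z, enorm (z - x) <= s / 2 -> G z <-> G' z.
Proof.
move=> op /andP[d0 d4] d'0 gG Gz0 z0x hloc.
have d2 : delta <= 2^-1 by lra.
have [sec [sG sp sL2]] := lip_graph_section op d2 gG.
pose D := [set v | exists z, [/\ G z, enorm (z - x) <= s & v = p z]].
pose A v := sec v - p (sec v).
have secE z : G z -> sec (p z) = z.
  by move=> Gz; apply: (lip_graph_inj op d2 gG) => //; rewrite sp orth_projK.
have AL y y' : D y -> D y' -> enorm (A y - A y') <= 2 * delta' * enorm (y - y').
  move=> [z [Gz zx ->]] [z' [Gz' zx' ->]]; rewrite /A !secE //.
  have -> : z - p z - (z' - p z') = (z - z') - p (z - z').
    by rewrite (orth_projB p) //; vring.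
  have := hloc _ _ Gz Gz' zx zx'.
  have := ler_wpM2l d'0 (lip_graph_dist op d2 gG Gz Gz'); lra.
have [B [BA BL]] := mcshane D A _ (mulr_ge0 (ler0n _ 2) d'0) AL.
(* [A] is the height function of [G], which has the good Lipschitz constant only over [D]. [B]
   extends it from [D], and removing its [p]-component keeps [F u] above [p u]. *)
pose F u := p u + (B (p u) - p (B (p u))).
have Fp u : p (F u) = p u.
  by rewrite /F (orth_projD p) // (orth_projB p) // !(orth_projK p) // subrr addr0.
exists (range F); split.
  split=> [_ _ [u _ <-] [u' _ <-]|v]; last by exists (F v); split=> //; exists v.
  have := enorm_coproj p (B (p u) - B (p u')) op.
  have := BL (p u) (p u').
  have -> : F u - F u' - p (F u - F u') =
     (B (p u) - B (p u')) - p (B (p u) - B (p u')).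
    by rewrite (orth_projB p (F u)) // !Fp (orth_projB p (B _)) // /F; vring.
  rewrite -(Fp u) -(Fp u') -(orth_projB p (F u)) //.
  have := enorm_proj p (F u - F u') op.
  have nd : 0 <= 2 * n%:R * delta' by rewrite !mulr_ge0.
  move=> /(ler_wpM2l nd); lra.
move=> z zx; split=> [Gz|[u _ zE]].
  have Dz : D (p z).
    by exists z; split=> //; have := enorm_ge0 (z - x); lra.
  by exists z => //; rewrite /F BA // /A secE // (orth_projB p) // (orth_projK p) //; vring.
(* A point of the new graph within [s / 2] of [x] must lie above [D]. The point [sec u] of [G] above
   the same base point has horizontal offset from [x] at most [s / 2] and vertical offset at most
   [delta * enorm t + s / 8]; as [delta] is at most 1/4, this keeps it within [s] of [x]. *)
have Dz : D (p u).
  exists (sec u); split; [exact: sG| |by rewrite sp].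
  have := gG.1 _ _ (sG u) Gz0; have := enorm_ge0 (sec u - z0).
  set t := sec u - z0 => t0.
  have := enormD (p (z - x)) ((t - p t) + ((z0 - x) - p (z0 - x))).
  have -> : p (z - x) + ((t - p t) + ((z0 - x) - p (z0 - x))) = sec u - x.
    by rewrite /t !(orth_projB p) // sp -zE Fp; vring.
  have := enormD (t - p t) ((z0 - x) - p (z0 - x)).
  have := enorm_coproj p (z0 - x) op; have := enorm_proj p (z - x) op.
  have := ler_wpM2r t0 d4.
  have := enormB (sec u - x) (z0 - x).
  have -> : sec u - x - (z0 - x) = t by rewrite /t; vring.
  lra.
rewrite -zE /F BA // /A -(sp u) secE; last exact: sG.
suff -> : p (sec u) + (sec u - p (sec u) - p (sec u - p (sec u))) = sec u.
  exact: sG.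
by rewrite (orth_projB p) // (orth_projK p) //; vring.
Qed.

End Graphs.

(** * Bi-Hoelder limits of near-identity maps *)

Section Scales.
Context {R : realType}.

Lemma scale10_gt0 k : 0 < scale10 R k.
Proof. by rewrite invr_gt0 exprn_gt0. Qed.

Lemma scale10_0 : scale10 R 0 = 1.
Proof. by rewrite /scale10 expr0 invr1. Qed.

Lemma scale10S k : scale10 R k = 10 * scale10 R k.+1.
Proof. by rewrite /scale10 exprS invfM mulrA divff // mul1r. Qed.

Lemma scale10E k : scale10 R k = 10^-1 ^+ k.
Proof. by rewrite /scale10 exprVn. Qed.

Lemma scale10_le j k : (j <= k)%N -> scale10 R k <= scale10 R j.
Proof.
by move=> jk; rewrite !scale10E ler_wiXn2l // ?invr_ge0 // invf_le1 // ler1n.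
Qed.

Lemma expR1_le4 : expR (1 : R) <= 4.
Proof.
have h : 2^-1 <= expR (- 2^-1 : R) by have := expR_ge1Dx (- 2^-1 : R); lra.
have : expR (- 2^-1 : R) * (expR (- 2^-1) * expR 1) = 1.
  rewrite -!expRD (_ : - 2^-1 + (- 2^-1 + 1) = 0) ?expR0 //; lra.
have e0 := expR_gt0 (1 : R).
have h2 : 2^-1 * expR 1 <= expR (- 2^-1) * expR (1 : R) by rewrite ler_pM2r.
have h3 : 2^-1 * (2^-1 * expR 1) <= expR (- 2^-1) * (expR (- 2^-1) * expR (1 : R)).
  by apply: ler_pM => //; lra.
move=> E; lra.
Qed.

(** Since [10 * (1 - lam)] exceeds e, the hypothesis gives [k <= - ln t]: the number of scales is
    logarithmic in the distance. Then (1 + lam)^k <= exp(lam k) and (1 - lam)^k >= exp(-2 lam k) are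
    controlled by powers of [t]. *)
Lemma iterated_factors_powR (lam t : R) k : 0 <= lam <= 4^-1 -> 0 < t ->
  (1 - lam) ^+ k * t <= scale10 R k ->
  (1 + lam) ^+ k * t <= t `^ (1 - lam) /\ t `^ (1 + 2 * lam) <= (1 - lam) ^+ k * t.
Proof.
move=> /andP[l0 l4] t0 tk; set L := ln t.
have tE : expR L = t by rewrite lnK.
have l1 : 0 < 1 - lam by lra.
have kL : k%:R + L <= 0.
  rewrite -ler_expR expR0 expRD tE -[k%:R]mulr1 expRM_natl.
  apply: (@le_trans _ _ ((10 * (1 - lam)) ^+ k * t)).
    rewrite ler_pM2r // lerXn2r ?nnegrE ?expR_ge0 //; first lra.
    have := expR1_le4; lra.
  rewrite exprMn -mulrA.
  have : 10 ^+ k * scale10 R k = 1 by rewrite /scale10 divff // expf_neq0.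
  move=> E; rewrite -[leRHS]E.
  by rewrite ler_pM2l // exprn_gt0.
have l2 : 0 <= (-L - k%:R) * lam by rewrite mulr_ge0 //; lra.
rewrite /powR gt_eqF // -/L; split.
  rewrite mulrBl mul1r expRD tE mulrC ler_pM2l //.
  apply: (@le_trans _ _ (expR lam ^+ k)).
    rewrite lerXn2r ?nnegrE ?expR_ge0 //; first lra.
    exact: expR_ge1Dx.
  rewrite -expRM_natl ler_expR; lra.
rewrite mulrDl mul1r expRD tE mulrC ler_pM2r //.
apply: (@le_trans _ _ (expR (- 2 * lam) ^+ k)).
  rewrite -expRM_natl ler_expR; lra.
rewrite lerXn2r ?nnegrE ?expR_ge0 //; first lra.
have e0 := expR_gt0 (-2 * lam).
have : expR (- 2 * lam) * expR (2 * lam) = 1.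
  by rewrite -expRD (_ : - 2 * lam + 2 * lam = 0) ?expR0 //; lra.
have h := ler_wpM2l (ltW e0) (expR_ge1Dx (2 * lam)).
have h2 : 0 <= lam * (1 - 2 * lam) by rewrite mulr_ge0 //; lra.
move=> E; have h3 : expR (- 2 * lam) * (1 + 2 * lam) <= (1 - lam) * (1 + 2 * lam).
  by rewrite E in h; lra.
by rewrite ler_pM2r in h3; last lra.
Qed.

End Scales.

Section Composition.
Context {R : realType} {n : nat}.
Variables (sigma : nat -> 'rV[R]_n -> 'rV[R]_n) (lam : R).
Hypotheses (lam_ge0 : 0 <= lam) (lam_small : n%:R * lam <= 32^-1).
Hypothesis lam_le : lam <= 32^-1.
Hypothesis sigma_lip : forall k, near_id lam (sigma k).
Hypothesis sigma_disp : forall k y, enorm (sigma k y - y) <= lam * scale10 R k.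

Fixpoint compose_upto k : 'rV[R]_n -> 'rV[R]_n :=
  if k is j.+1 then sigma j \o compose_upto j else id.
Local Notation f := compose_upto.

Lemma compose_upto_ge k x x' :
  (1 - lam) ^+ k * enorm (x - x') <= enorm (f k x - f k x').
Proof.
elim: k => [|k IH]; first by rewrite expr0 mul1r.
apply: le_trans (near_id_ge _ _ (sigma_lip k)).
by rewrite exprS -mulrA ler_wpM2l //; have := lam_le; lra.
Qed.

Lemma compose_upto_le k x x' :
  enorm (f k x - f k x') <= (1 + lam) ^+ k * enorm (x - x').
Proof.
elim: k => [|k IH]; first by rewrite expr0 mul1r.
apply: le_trans (near_id_le _ _ (sigma_lip k)) _.
by rewrite exprS -mulrA ler_wpM2l //; have := lam_ge0; lra.
Qed.

Lemma compose_upto_surj k y : exists x, f k x = y.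
Proof.
elim: k y => [|k IH] y; first by exists y.
have hL u u' : enorm ((sigma k u - u) - (sigma k u' - u'))
    <= 2^-1 * enorm (u - u').
  apply: le_trans (sigma_lip k u u') _; rewrite ler_wpM2r ?enorm_ge0 //.
  have := lam_le; lra.
have [u hu] := id_plus_contraction_surj (fun u => sigma k u - u) hL y.
have [x xu] := IH u.
by exists x; rewrite /= xu -hu addrC subrK.
Qed.

(* The first scale [k] with [|f k x - f k x'| >= 10^-k] decides: before it the
   distance is multiplied by factors in [1 - lam, 1 + lam], and after it the
   points move by at most a small multiple of [10^-k]. *)
Lemma limit_bi_holder (g : 'rV[R]_n -> 'rV[R]_n) :
  (forall k x, enorm (g x - f k x) <= 16^-1 * scale10 R k) ->
  forall x x', enorm (x' - x) <= 1 ->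
    4^-1 * enorm (x' - x) `^ (1 + 2 * lam) <= enorm (g x' - g x)
      <= 3 * enorm (x' - x) `^ (1 - lam).
Proof.
move=> gf x x'; set t := enorm (x' - x) => t1.
have [t0|t0] := leP t 0.
  have te : t = 0 by apply/eqP; rewrite eq_le t0 enorm_ge0.
  have -> : x' = x by apply/eqP; rewrite -subr_eq0; apply/eqP/enorm0_eq0.
  rewrite te subrr enorm0 !powR0 ?mulr0 ?lexx //; apply/eqP;
    have := lam_le; have := lam_ge0; lra.
pose d k := enorm (f k x' - f k x).
have dge k : (1 - lam) ^+ k * t <= d k by apply: compose_upto_ge.
(* Otherwise the lower bound with factor [1 - lam >= 1/2] would give [t <= 5^-k] for all [k]. *)
have exk : exists k, scale10 R k <= d k.
  apply: contrapT => nk.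
  suff : t <= 0 by rewrite leNgt t0.
  have q5 : 0 <= (5^-1 : R) <= 2^-1 by lra.
  apply: (@le_geometric_le0 _ t 1 _ q5) => k.
  have := dge k; have [|dk] := leP (scale10 R k) (d k); first by move=> h _; case: nk; exists k.
  move=> /le_trans - /(_ _ (ltW dk)); rewrite scale10E mul1r.
  have l2 : 2^-1 ^+ k <= (1 - lam) ^+ k.
    by rewrite lerXn2r ?nnegrE //; have := lam_le; lra.
  move=> /(le_trans (ler_wpM2r (ltW t0) l2)).
  have -> : (10^-1 : R) = 2^-1 * 5^-1 by lra.
  by rewrite exprMn ler_pM2l // exprn_gt0.
have [k kd kmin] := ex_minnP exk.
have dk0 : 0 < d k by apply: lt_le_trans kd; exact: scale10_gt0.
(* The two tails together move the points by at most [scale10 R k / 8], which is at most [d k / 8]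
   by the choice of [k]. *)
have gd : (1 - 8^-1) * d k <= enorm (g x' - g x) <= (1 + 8^-1) * d k.
  have h1 := gf k x; have h2 := gf k x'.
  have h3 := enormD (g x' - f k x' - (g x - f k x)) (f k x' - f k x).
  have h4 := enormB (g x' - g x) (g x' - f k x' - (g x - f k x)).
  have h5 := enormB (g x' - f k x') (g x - f k x).
  have e1 : g x' - f k x' - (g x - f k x) + (f k x' - f k x) = g x' - g x.
    by vring.
  have e2 : g x' - g x - (g x' - f k x' - (g x - f k x)) = f k x' - f k x.
    by vring.
  move: h3 h4; rewrite e1 e2 -/(d k) => h3 h4.
  by move: kd h1 h2 h3 h4 h5; rewrite -/(d k) => *; apply/andP; split; lra.
have pw : d k <= (1 + lam) * t `^ (1 - lam) /\
    (1 - lam) * t `^ (1 + 2 * lam) <= d k.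
  have l4 : 0 <= lam <= 4^-1 by have := lam_le; have := lam_ge0; lra.
  have p1 : 0 <= t `^ (1 - lam) := powR_ge0 _ _.
  have p2 : 0 <= t `^ (1 + 2 * lam) := powR_ge0 _ _.
  (* At [k = 0] the hypothesis [t <= 1] is what is needed. Otherwise minimality gives the upper
     bound on the distance at the previous scale, and the last map costs one more factor [1 + lam]
     or [1 - lam]. *)
  case: k kd kmin dk0 gd => [|k] kd kmin dk0 gd.
    have := iterated_factors_powR lam t 0 l4 t0.
    rewrite !expr0 !mul1r scale10_0 => /(_ t1)[h1 h2].
    have -> : d 0%N = t by [].
    have h3 : 0 <= lam * t `^ (1 - lam) by rewrite mulr_ge0.
    have h4 : 0 <= lam * t `^ (1 + 2 * lam) by rewrite mulr_ge0.
    split; lra.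
  have dk : d k < scale10 R k.
    by rewrite ltNge; apply/negP => /kmin; rewrite ltnn.
  have := iterated_factors_powR lam t k l4 t0 (le_trans (dge k) (ltW dk)).
  move=> [h1 h2]; split.
    apply: le_trans (compose_upto_le k.+1 x' x) _; rewrite exprS -mulrA.
    by rewrite ler_wpM2l //; lra.
  apply: le_trans (dge k.+1); rewrite exprS -mulrA.
  by rewrite ler_wpM2l //; lra.
have p1 : 0 <= t `^ (1 - lam) := powR_ge0 _ _.
have p2 : 0 <= t `^ (1 + 2 * lam) := powR_ge0 _ _.
have m1 := ler_wpM2r p1 lam_le; have m2 := ler_wpM2r p2 lam_le.
by case: pw => *; case/andP: gd => *; apply/andP; split; lra.
Qed.

(** Injectivity follows from the lower Hoelder bound at distance at most 1, and from the small total
    displacement beyond. For surjectivity, the preimages [u k] of [y] under the stages form a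
    geometric sequence: a displacement of order 10^-k is pulled back with a factor of at most 2^k.
    The limit works because the expansion [(1 + lam) ^+ k <= 2 ^+ k] is beaten by 5^-k. *)
Lemma compose_limit : exists g : 'rV[R]_n -> 'rV[R]_n,
  (forall k x, enorm (g x - f k x) <= 2 * n%:R * lam * scale10 R k) /\ bijective g.
Proof.
have q10 : 0 <= (10^-1 : R) <= 2^-1 by lra.
have /choice[g gf] : forall x, exists l, forall k,
    enorm (l - f k x) <= 2 * n%:R * lam * scale10 R k.
  move=> x; have hk k : enorm (f k.+1 x - f k x) <= lam * 10^-1 ^+ k.
    by rewrite -scale10E; apply: sigma_disp.
  have [l hl] := geometric_limit (fun k => f k x) lam _ q10 hk.
  by exists l => k; have := hl k; rewrite scale10E; lra.
exists g; split=> [k x|]; first exact: gf.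
have gf16 k x : enorm (g x - f k x) <= 16^-1 * scale10 R k.
  apply: le_trans (gf x k) _; rewrite ler_pM2r ?scale10_gt0 //.
  have := lam_small; lra.
have ginj : injective g.
  move=> x x' gxx'; have [xx1|xx1] := leP (enorm (x' - x)) 1.
    have /andP[] := limit_bi_holder _ gf16 _ _ xx1.
    rewrite gxx' subrr enorm0 => h _.
    have [h0|h0] := leP (enorm (x' - x)) 0.
      by apply/esym/eqP; rewrite -subr_eq0; apply/eqP/enorm0_eq0.
    have h1 : 0 < enorm (x' - x) `^ (1 + 2 * lam) by apply: powR_gt0.
    by exfalso; lra.
  have := gf16 0%N x; have := gf16 0%N x'; rewrite gxx' scale10_0 /=.
  have := enormB (g x' - x) (g x' - x').
  have -> : g x' - x - (g x' - x') = x' - x by vring.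
  by move=> *; exfalso; lra.
have gsurj y : exists x, g x = y.
  have /choice[u hu] := fun k => compose_upto_surj k y.
  have q5 : 0 <= (5^-1 : R) <= 2^-1 by lra.
  have uc k : enorm (u k.+1 - u k) <= lam * 5^-1 ^+ k.
    have := compose_upto_ge k (u k.+1) (u k).
    have := sigma_disp k (f k (u k.+1)).
    have /= -> := hu k.+1; rewrite enorm_distC hu => h1 /le_trans - /(_ _ h1).
    rewrite scale10E => h2.
    have l2 : 2^-1 ^+ k <= (1 - lam) ^+ k.
      by rewrite lerXn2r ?nnegrE //; have := lam_le; lra.
    have := le_trans (ler_wpM2r (enorm_ge0 (u k.+1 - u k)) l2) h2.
    have -> : (10^-1 : R) = 2^-1 * 5^-1 by lra.
    by rewrite exprMn mulrCA ler_pM2l // exprn_gt0.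
  have [l hl] := geometric_limit u lam _ q5 uc.
  exists l; apply/eqP; rewrite -subr_eq0; apply/eqP/enorm0_eq0.
  have half : 0 <= (2^-1 : R) <= 2^-1 by lra.
  apply: (@le_geometric_le0 _ _ (4 * n%:R * lam) _ half) => k.
  have h1 := gf l k; have h2 := compose_upto_le k l (u k).
  have h3 := hl k; rewrite hu in h2.
  have l2 : (1 + lam) ^+ k <= 2 ^+ k.
    by rewrite lerXn2r ?nnegrE //; have := lam_le; have := lam_ge0; lra.
  have nl : 0 <= n%:R * lam by rewrite mulr_ge0.
  have s1 : n%:R * lam * scale10 R k <= n%:R * lam * 2^-1 ^+ k.
    by rewrite ler_wpM2l // scale10E lerXn2r ?nnegrE //; lra.
  have s2 : enorm (f k l - y) <= 2 ^+ k * (n%:R * (2 * lam * 5^-1 ^+ k)).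
    apply: le_trans h2 _; apply: (ler_pM _ (enorm_ge0 _) l2 h3).
    by rewrite exprn_ge0 //; have := lam_ge0; lra.
  have s3 : 2 ^+ k * 5^-1 ^+ k <= (2^-1 : R) ^+ k.
    by rewrite -exprMn lerXn2r ?nnegrE //; lra.
  have s4 := ler_wpM2l nl s3.
  have := enorm_dist_tri (f k l) (g l) y; lra.
have [h hK] := choice gsurj.
by exists h => // x; apply: ginj; rewrite hK.
Qed.

End Composition.

(** * Planes and orthogonal projections *)

Section Planes.
Context {R : realType} {n : nat}.
Implicit Types (u v w x y z : 'rV[R]_n) (V : {vspace 'rV[R]_n}).

Definition orth_proj_on V (p : 'rV[R]_n -> 'rV[R]_n) :=
  orth_proj p /\ forall u, u \in V <-> p u = u.

(** Gram-Schmidt, one vector at a time: add the projection on [w = x - p x], unless [w] vanishes and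
    [x] is already in the span. *)
Lemma orth_proj_span (X : seq 'rV[R]_n) : exists p, orth_proj_on <<X>>%VS p.
Proof.
elim: X => [|x X [p [op pX]]].
  exists (fun=> 0); split=> [|u]; last first.
    by rewrite span_nil memv0; split=> [/eqP ->|->].
  split=> [a u v|u|u v] //; first by rewrite scaler0 addr0.
  by rewrite -(scale0r 0) dotpZl dotpZr !mul0r.
set w := x - p x.
have pw : p w = 0 by rewrite /w (orth_projB p) // (orth_projK p) // subrr.
have [pl _ pT] := op.
have pX0 u : p u \in <<X>>%VS by apply/pX; rewrite orth_projK.
have [w0|w0] := leP (enorm w) 0.
  have xX : x \in <<X>>%VS.
    by apply/pX/eqP; rewrite eq_sym -subr_eq0 -/w; apply/eqP/enorm0_eq0.
  exists p; split=> // u; rewrite -pX span_cons.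
  suff -> : (<[x]> + <<X>> = <<X>>)%VS by [].
  by apply/addv_idPr; rewrite -memvE.
have ww : dotp w w != 0 by rewrite -sqr_enorm expf_neq0 // gt_eqF.
pose q u := p u + (dotp u w / dotp w w) *: w.
have qT u v : dotp (q u) v = dotp u (q v).
  rewrite /q dotpDl dotpDr dotpZl dotpZr pT (dotpC w v); ring.
have dpw u : dotp (p u) w = 0 by rewrite pT pw -(scale0r 0) dotpZr mul0r.
have qq u : q (q u) = q u.
  rewrite {1 2}/q (orth_projD p) // (orth_projK p) // (orth_projZ p) // pw.
  rewrite scaler0 addr0 dotpDl dpw add0r dotpZl -mulrA divff // mulr1.
  by [].
exists q; split.
  split=> // a u v; rewrite /q pl dotpDl dotpZl.
  by move: (dotp u w) (dotp v w) (dotp w w) => b c e; vring.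
move=> u; rewrite span_cons; split.
  move=> /memv_addP[_ /vlineP[a ->] [v /pX pv ->]].
  have dv : dotp v w = 0 by rewrite -pv dpw.
  rewrite /q dotpDl dotpZl dv addr0.
  have -> : dotp x w = dotp w w by rewrite {2}/w dotpBl dpw subr0.
  rewrite -mulrA divff // mulr1 (orth_projD p) // (orth_projZ p) // pv /w.
  by vring.
move=> <-; rewrite /q /w scalerBr addrC -addrA memv_add //.
  by rewrite memvZ // memv_line.
by rewrite memvD ?memvN ?memvZ.
Qed.

Lemma orth_proj_vspace V : exists p, orth_proj_on V p.
Proof. by rewrite -(span_basis (vbasisP V)); apply: orth_proj_span. Qed.

Lemma orth_proj_mem V p u : orth_proj_on V p -> p u \in V.
Proof. by move=> [op pV]; apply/pV; rewrite orth_projK. Qed.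

Lemma dist_set_le_enorm y z (A : set 'rV[R]_n) (c : R) : A z ->
  enorm (y - z) <= c -> (dist_set y A <= c%:E)%E.
Proof.
move=> Az yz; apply: (@le_trans _ _ (enorm (y - z))%:E); last by rewrite lee_fin.
by apply: ereal_inf_lbound; exists z.
Qed.

Lemma le_of_dist_set y (A : set 'rV[R]_n) (b c : R) :
  (dist_set y A <= c%:E)%E -> (forall z, A z -> b <= enorm (y - z)) -> b <= c.
Proof.
move=> dc bA; rewrite -lee_fin; apply: le_trans dc.
by apply: le_ereal_inf_tmp => _ [z Az <-]; rewrite lee_fin; apply: bA.
Qed.

Lemma dist_plane_ge x y V p (c : R) : orth_proj_on V p ->
  (dist_set y (plane x V) <= c%:E)%E -> enorm ((y - x) - p (y - x)) <= c.
Proof.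
move=> [op pV] /le_of_dist_set; apply=> z /pV zV.
have -> : y - x - p (y - x) = (y - z) - p (y - z).
  have -> : y - z = (y - x) - (z - x) by vring.
  by rewrite (orth_projB p (y - x)) // zV; vring.
exact: enorm_coproj.
Qed.

Lemma local_hausdorff_le x (r c : R) (E F : set 'rV[R]_n) : 0 < r ->
  (local_hausdorff x r E F <= c%:E)%E <->
  (forall y, E y -> enorm (y - x) <= r -> (dist_set y F <= (c * r)%:E)%E) /\
  (forall y, F y -> enorm (y - x) <= r -> (dist_set y E <= (c * r)%:E)%E).
Proof.
move=> r0; rewrite /local_hausdorff lee_pdivrMl // ge_max -EFinM (mulrC r).
split=> [/andP[/ereal_supP h1 /ereal_supP h2]|[h1 h2]].
  by split=> y Ey yx; [apply: h1|apply: h2]; exists y.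
by apply/andP; split; apply/ereal_supP => _ [y [Ey yx] <-]; [apply: h1|apply: h2].
Qed.

Lemma enorm_coproj_homogeneous p p' (s c : R) : orth_proj p -> orth_proj p' ->
  0 < s -> (forall v, p v = v -> enorm v <= s -> enorm (v - p' v) <= c * s) ->
  forall u, enorm (p u - p' (p u)) <= c * enorm u.
Proof.
move=> op op' s0 h u; set v := p u.
have c0 : 0 <= c.
  have := h 0 (orth_proj0 p op); rewrite (orth_proj0 p') // subr0 enorm0.
  by move=> /(_ (ltW s0)); rewrite pmulr_lge0.
have [v0|v0] := leP (enorm v) 0.
  rewrite (enorm0_eq0 _ v0) (orth_proj0 p') // subr0 enorm0.
  by rewrite mulr_ge0 // enorm_ge0.
pose a := s / enorm v.
have a0 : 0 < a by rewrite divr_gt0.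
have := h (a *: v); rewrite (orth_projZ p) // {1}/v (orth_projK p) // -/v.
rewrite (orth_projZ p') // -scalerBr !enormZ gtr0_norm //.
rewrite {1}/a divfK ?gt_eqF // => /(_ erefl (lexx _)).
have -> : c * s = a * (c * enorm v) by rewrite /a mulrCA divfK ?gt_eqF.
rewrite ler_pM2l // => /le_trans; apply.
by rewrite ler_wpM2l // enorm_proj.
Qed.

(** Subtracting the estimate at [v = 0] turns affine gaps into linear ones, of size [2 * eps * r].
    On the side of [V'] only vectors of length [r / 2] are available, the ball being centred at [x],
    so the relative gap is [4 * eps]; [orth_proj_close] doubles it to 8. *)
Lemma local_hausdorff_planes x x' V V' p p' (r eps : R) : 0 < r ->
  orth_proj_on V p -> orth_proj_on V' p' -> enorm (x' - x) <= r / 2 ->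
  (local_hausdorff x r (plane x V) (plane x' V') <= eps%:E)%E ->
  (forall u, enorm (p u - p' u) <= 8 * eps * enorm u) /\
  enorm ((x - x') - p' (x - x')) <= eps * r.
Proof.
move=> r0 oV oV' xx' /(local_hausdorff_le _ _ _ _ _ r0)[h1 h2].
have [op pV] := oV; have [op' pV'] := oV'.
have g1 v : p v = v -> enorm v <= r ->
    enorm ((v + (x - x')) - p' (v + (x - x'))) <= eps * r.
  move=> /pV vV vr; have -> : v + (x - x') = (v + x) - x' by rewrite addrA.
  apply: (dist_plane_ge _ _ _ _ _ oV'); apply: h1; last by rewrite addrK.
  by rewrite /plane /= addrK.
have g2 v : p' v = v -> enorm v <= r / 2 ->
    enorm ((v + (x' - x)) - p (v + (x' - x))) <= eps * r.
  move=> /pV' vV vr; have -> : v + (x' - x) = (v + x') - x by rewrite addrA.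
  apply: (dist_plane_ge _ _ _ _ _ oV); apply: h2.
    by rewrite /plane /= addrK.
  by rewrite -addrA; apply: le_trans (enormD _ _) _; lra.
have e0 := g1 0 (orth_proj0 p op); have e0' := g2 0 (orth_proj0 p' op').
rewrite enorm0 !add0r in e0 e0'.
have {}e0 := e0 (ltW r0).
have {}e0' := e0' (ltW (divr_gt0 r0 (ltr0n _ 2))).
split=> // u; have -> : 8 * eps * enorm u = 2 * (4 * eps) * enorm u by ring.
have r2 : 0 < r / 2 by rewrite divr_gt0.
apply: orth_proj_close => //.
- have er : 0 <= eps * r := le_trans (enorm_ge0 _) e0.
  apply: (enorm_coproj_homogeneous _ _ r) => // v pv vr.
  have := enormB (v + (x - x') - p' (v + (x - x'))) (x - x' - p' (x - x')).
  have -> : v + (x - x') - p' (v + (x - x')) - (x - x' - p' (x - x')) = v - p' v.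
    by rewrite (orth_projD p' v) //; vring.
  have := g1 v pv vr; lra.
- apply: (enorm_coproj_homogeneous _ _ (r / 2)) => // v pv vr.
  have := enormB (v + (x' - x) - p (v + (x' - x))) (x' - x - p (x' - x)).
  have -> : v + (x' - x) - p (v + (x' - x)) - (x' - x - p (x' - x)) = v - p v.
    by rewrite (orth_projD p v) //; vring.
  have := g2 v pv vr; lra.
Qed.

End Planes.

(** * Model surfaces as Lipschitz graphs *)

Section FlatSurfaces.
Context {R : realType} {n : nat}.
Implicit Types (u v w x y z : 'rV[R]_n) (V : {vspace 'rV[R]_n}).
Implicit Type F : 'rV[R]_n -> 'rV[R]_n.

Lemma continuous_dotp w : continuous (fun u => dotp u w).
Proof.
have C (i : 'I_n) : continuous (fun u : 'rV[R]_n => u 0 i * w 0 i).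
  by move=> u; apply: continuousM; [exact: coord_continuous|exact: cst_continuous].
rewrite /dotp => u; elim: (index_enum _) => [|i r IH].
  rewrite (_ : (fun _ : 'rV[R]_n => _) = cst 0); first exact: cst_continuous.
  by apply/funext => v; rewrite big_nil.
rewrite (_ : (fun _ : 'rV[R]_n => _) =
    fun v => v 0 i * w 0 i + \sum_(j <- r) v 0 j * w 0 j).
  exact: (continuousD (C i u) IH).
by apply/funext => v; rewrite big_cons.
Qed.

Lemma is_derive_dotp_line F x v w (t : R) : derivable F (x + t *: v) v ->
  is_derive t 1 (fun s : R => dotp (F (x + s *: v)) w)
    (dotp ('D_v F (x + t *: v)) w).
Proof.
move=> dF; set phi := fun s : R => _.
have C : (fun h : R => h^-1 *: ((phi \o shift t) (h *: 1) - phi t)) @ 0^' -->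
    dotp ('D_v F (x + t *: v)) w.
  have := cvg_comp _ _ dF (continuous_dotp w _).
  apply: cvg_trans; apply: near_eq_cvg; near=> h => /=.
  rewrite dotpZl dotpBl /phi; congr (_ * (dotp (F _) w - _)).
  by rewrite /shift /= scalerDl [h *: 1]mulr1 addrC -addrA [_ + h *: v]addrC.
by apply: DeriveDef; [exact: cvgP C|exact: cvg_lim C].
Unshelve. all: by end_near. Qed.

(** The scalar mean value theorem is applied to the component of [F] along the increment [w] itself,
    which gives [enorm w ^+ 2 <= c * L * enorm w]. *)
Lemma mean_value_enorm F x v (c L : R) : 0 <= L ->
  (forall t : R, derivable F (x + t *: v) v) ->
  (forall t : R, enorm ('D_v F (x + t *: v)) <= c) ->
  enorm (F (x + L *: v) - F x) <= c * L.
Proof.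
move=> L0 dF Fc; set w := F (x + L *: v) - F x.
have dphi (t : R) : is_derive t (1 : R) (fun s : R => dotp (F (x + s *: v)) w)
    (dotp ('D_v F (x + t *: v)) w) by apply: is_derive_dotp_line.
have [|t _] := MVT_segment L0 (fun t _ => dphi t).
  by apply: derivable_within_continuous => t _; case: (dphi t).
rewrite scale0r addr0 subr0 -dotpBl -/w -sqr_enorm => E.
have [w0|w0] := leP (enorm w) 0.
  by apply: le_trans w0 _; rewrite mulr_ge0 //; apply: le_trans (enorm_ge0 _) (Fc 0).
rewrite -(ler_pM2r w0) -expr2 E mulrAC ler_wpM2r //.
apply: le_trans (cauchy_schwarz _ _) _.
by rewrite ler_pM2r.
Qed.

Lemma deriv_norm_ge F V y k : (0 <= deriv_norm k V F y)%E.
Proof.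
apply: le_ereal_sup_tmp; exists (enorm (iter_derive (nseq k 0) F y))%:E.
  exists (nseq k 0) => //; split; first by rewrite size_nseq.
  by move=> v; rewrite mem_nseq => /andP[_ /eqP ->]; rewrite mem0v enorm0.
by rewrite lee_fin enorm_ge0.
Qed.

(** As [F] is orthogonal to [V], the vertical part of a chord of the graph is an increment of [F].
    The bound on the first derivative, integrated along a segment inside the plane, makes it at most
    [eps] times the horizontal part. *)
Lemma flat_model_lip_graph {d} {eps : R} {Sigma PS x} :
  flat_model_surface d eps Sigma PS -> Sigma x ->
  exists V p G, [/\ \dim V = d, PS x = plane x V, orth_proj_on V p,
    lip_graph p eps G & forall z, enorm (z - x) <= 200 -> Sigma z <-> G z].
Proof.
move=> [_ h] /h[V [F [[dV PSx CF] [Forth Fn Sx]]]].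
have [p oV] := orth_proj_vspace V; have [op pV] := oV.
exists V, p, [set y + F y | y in PS x]; split=> //; last first.
  move=> z zx; split=> [Sz|Gz].
    by have [] : ([set y + F y | y in PS x] `&` eball x 200) z by rewrite -Sx; split.
  by have [] : (Sigma `&` eball x 200) z by rewrite Sx; split.
have pF y : PS x y -> p (F y) = 0.
  move=> Py; apply/enorm0_eq0; rewrite -(@ler_pXn2r _ 2) ?nnegrE ?enorm_ge0 //.
  have [_ pp pT] := op.
  by rewrite sqr_enorm pT pp (Forth _ Py _ (orth_proj_mem _ _ _ oV)) expr0n.
have dvF y v : PS x y -> v \in V -> enorm v <= 1 -> enorm ('D_v F y) <= eps.
  move=> Py vV v1; rewrite -lee_fin; apply: le_trans (Fn y Py).
  apply: le_trans (leeDl _ (deriv_norm_ge F V y 2)).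
  apply: (@le_trans _ _ (deriv_norm 1 V F y)); last first.
    by apply: leeDr; rewrite lee_fin enorm_ge0.
  apply: ereal_sup_ubound; exists [:: v] => //; split=> // u.
  by rewrite !inE => /eqP ->.
have Flip y y' : PS x y -> PS x y' -> enorm (F y - F y') <= eps * enorm (y - y').
  rewrite PSx => Py Py'; set L := enorm (y - y').
  have yV : y - y' \in V.
    have -> : y - y' = (y - x) - (y' - x) by vring.
    exact: rpredB.
  have [L0|L0] := leP L 0.
    have -> : y = y' by apply/eqP; rewrite -subr_eq0; apply/eqP/enorm0_eq0.
    rewrite subrr enorm0; have -> : L = 0 by apply/eqP; rewrite eq_le L0 enorm_ge0.
    by rewrite mulr0.
  pose v := L^-1 *: (y - y').
  have vV : v \in V by rewrite memvZ.
  have v1 : enorm v <= 1.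
    by rewrite enormZ ger0_norm ?invr_ge0 ?enorm_ge0 // mulVf // gt_eqF.
  have yE : y = y' + L *: v.
    by rewrite /v scalerA divff ?gt_eqF // scale1r addrC subrK.
  have PSt t : PS x (y' + t *: v).
    rewrite PSx /plane /= (_ : _ - x = (y' - x) + t *: v); last by vring.
    by rewrite rpredD ?memvZ.
  rewrite {1}yE; apply: mean_value_enorm; first exact: ltW.
    move=> t; have [|_ /(_ isT)] := CF [::] _ isT; first by move=> u; rewrite inE.
    by apply.
  by move=> t; apply: dvF.
split=> [_ _ [y Py <-] [y' Py' <-]|v].
  have pyy : p (y - y') = y - y'.
    apply/pV; move: Py Py'; rewrite PSx => Py Py'.
    have -> : y - y' = (y - x) - (y' - x) by vring.
    exact: rpredB.
  have e1 : y + F y - (y' + F y') = (y - y') + (F y - F y') by vring.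
  have e2 : p (y + F y - (y' + F y')) = y - y'.
    by rewrite e1 (orth_projD p) // pyy (orth_projB p) // !pF // subrr addr0.
  have e3 : y + F y - (y' + F y') - (y - y') = F y - F y' by vring.
  rewrite e2 e3; apply: le_trans (Flip _ _ Py Py') _.
  have eps0 : 0 <= eps.
    apply: le_trans (dvF _ 0 Py (mem0v _) _); rewrite ?enorm_ge0 //.
    by rewrite enorm0.
  by rewrite ler_wpM2l // -{1}e2 enorm_proj.
pose y := x + p (v - x).
have Py : PS x y.
  by rewrite PSx /plane /= /y addrAC subrr add0r (orth_proj_mem _ _ _ oV).
exists (y + F y); split; first by exists y.
rewrite (orth_projD p) // pF // addr0 /y (orth_projD p) // (orth_projK p) //.
by rewrite (orth_projB p) // addrC subrK.
Qed.

End FlatSurfaces.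

(** * The deformation at one scale *)

Section OneScale.
Context {R : realType} {n : nat}.
Implicit Types (u v w x y z : 'rV[R]_n).
Variables (E : set 'rV[R]_n) (p : 'rV[R]_n -> 'rV[R]_n -> 'rV[R]_n).
Variables (eps r : R).
Hypotheses (eps_gt0 : 0 < eps) (r_gt0 : 0 < r).
Hypothesis p_proj : forall x, E x -> orth_proj (p x).
Hypothesis p_close : forall x x', E x -> E x' -> enorm (x' - x) <= 50 * r ->
  (forall u, enorm (p x u - p x' u) <= 8 * eps * enorm u) /\
  enorm ((x - x') - p x' (x - x')) <= 100 * eps * r.

Definition aff_proj x y := x + p x (y - x).

Lemma aff_proj_lip x y y' : E x ->
  aff_proj x y - aff_proj x y' = p x (y - y').
Proof.
move=> Ex; have op := p_proj _ Ex; rewrite /aff_proj.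
have -> : y - y' = (y - x) - (y' - x) by vring.
by rewrite (orth_projB (p x) (y - x)) //; vring.
Qed.

Lemma aff_proj_close x x' y : E x -> E x' -> enorm (x' - x) <= 50 * r ->
  enorm (y - x) <= 6 * r -> enorm (aff_proj x' y - aff_proj x y) <= 200 * eps * r.
Proof.
move=> Ex Ex' xx' yx; have [h1 h2] := p_close _ _ Ex Ex' xx'.
have -> : aff_proj x' y - aff_proj x y =
    - (((x - x') - p x' (x - x')) + (p x (y - x) - p x' (y - x))).
  rewrite /aff_proj; have -> : y - x' = (y - x) + (x - x') by vring.
  by rewrite (orth_projD (p x') (y - x)) //; [vring|exact: p_proj].
rewrite enormN; apply: le_trans (enormD _ _) _.
have := h1 (y - x); have := ler_wpM2l (ltW eps_gt0) yx.
have : 0 <= eps * r by rewrite mulr_ge0 // ltW.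
lra.
Qed.

(* The penalty [20 eps |x - y|] makes the points [x] far from [y] irrelevant in
   the infimum, so near [x0] this is an infimum of functions that are all
   [eps]-close to [aff_proj x0], which replaces a partition of unity. *)
Definition glued_proj y : 'rV[R]_n := \row_i
  inf_over [set x | E x /\ enorm (x - y) <= 40 * r]
    (fun x => aff_proj x y 0 i + 20 * eps * enorm (x - y)).

Lemma glued_projE y i : glued_proj y 0 i =
  inf_over [set x | E x /\ enorm (x - y) <= 40 * r]
    (fun x => aff_proj x y 0 i + 20 * eps * enorm (x - y)).
Proof. by rewrite mxE. Qed.

Section Near.
Variables (x0 : 'rV[R]_n) (i : 'I_n).
Hypothesis Ex0 : E x0.

Let er_ge0 : 0 <= eps * r. Proof. by rewrite mulr_ge0 // ltW. Qed.

Lemma glued_term_ge y x : enorm (y - x0) <= 6 * r -> E x ->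
  enorm (x - y) <= 40 * r -> aff_proj x0 y 0 i - 200 * eps * r <= aff_proj x y 0 i.
Proof.
move=> yx0 Ex xy; have xx0 : enorm (x - x0) <= 50 * r.
  by have := enorm_dist_tri y x x0; have := r_gt0; lra.
have := le_trans (enorm_coord _ i) (aff_proj_close _ _ _ Ex0 Ex xx0 yx0).
by rewrite coordB ler_norml; lra.
Qed.

Lemma glued_penalty_ge0 x y : 0 <= 20 * eps * enorm (x - y).
Proof. by rewrite mulr_ge0 ?enorm_ge0 // mulr_ge0 // ltW. Qed.

Lemma glued_proj_le y x : enorm (y - x0) <= 6 * r -> E x ->
  enorm (x - y) <= 40 * r ->
  glued_proj y 0 i <= aff_proj x y 0 i + 20 * eps * enorm (x - y).
Proof.
move=> yx0 Ex xy; rewrite glued_projE.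
apply: (inf_over_le (aff_proj x0 y 0 i - 200 * eps * r)); last by split.
move=> z [Ez zy]; have := glued_term_ge _ _ yx0 Ez zy.
by have := glued_penalty_ge0 z y; lra.
Qed.

Lemma glued_proj_le_center y : enorm (y - x0) <= 6 * r ->
  glued_proj y 0 i <= aff_proj x0 y 0 i + 120 * eps * r.
Proof.
move=> yx0; have yx : enorm (x0 - y) <= 6 * r by rewrite enorm_distC.
have := glued_proj_le _ _ yx0 Ex0.
have := ler_wpM2l (ltW eps_gt0) yx => h1 h2.
by have := h2 (le_trans yx _); rewrite ler_pM2r // ler_nat => /(_ isT); lra.
Qed.

Lemma glued_proj_ge y (b : R) : enorm (y - x0) <= 6 * r ->
  (forall x, E x -> enorm (x - y) <= 40 * r ->
    b <= aff_proj x y 0 i + 20 * eps * enorm (x - y)) -> b <= glued_proj y 0 i.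
Proof.
move=> yx0 h; rewrite glued_projE.
apply: (@le_inf_over _ _ _ _ _ x0) => [|x [Ex xy]]; last exact: h.
by split=> //; rewrite enorm_distC; apply: le_trans yx0 _; rewrite ler_pM2r // ler_nat.
Qed.

(** For a fixed competitor [x], passing from [y] to [y'] changes [aff_proj x - aff_proj x0] by at
    most [8 * eps] and the penalty by at most [20 * eps] per unit length; the sum is 28. The
    delicate point is that the set of competitors varies with the point. *)
Lemma glued_proj_lip_coord y y' :
  enorm (y - x0) <= 6 * r -> enorm (y' - x0) <= 6 * r ->
  glued_proj y' 0 i - aff_proj x0 y' 0 i - 28 * eps * enorm (y - y')
    <= glued_proj y 0 i - aff_proj x0 y 0 i.
Proof.
move=> yx0 y'x0; rewrite lerBrDr; apply: glued_proj_ge => // x Ex xy.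
have xx0 : enorm (x - x0) <= 50 * r.
  by have := enorm_dist_tri y x x0; have := r_gt0; lra.
have yy' : enorm (y - y') <= 12 * r.
  by have := enorm_dist_tri x0 y y'; rewrite (enorm_distC x0 y'); lra.
have e0 : 0 <= eps * enorm (y - y') by rewrite mulr_ge0 ?enorm_ge0 // ltW.
(* Beyond [20 * r] the penalty exceeds [400 * eps * r], more than the 200 lost in [glued_term_ge]
   plus the 120 of [glued_proj_le_center], so the competitor loses. Within [20 * r] it is still
   admissible for [y'], as 20 + 12 is at most 40. *)
have [near|far] := leP (enorm (x - y)) (20 * r); last first.
  have := glued_proj_le_center _ y'x0; have := glued_term_ge _ _ yx0 Ex xy.
  by have := ler_wpM2l (ltW eps_gt0) (ltW far); have := er_ge0; lra.
have xy' : enorm (x - y') <= enorm (x - y) + enorm (y - y').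
  exact: enorm_dist_tri.
have xy40 : enorm (x - y') <= 40 * r by have := r_gt0; lra.
have h1 := glued_proj_le _ _ y'x0 Ex xy40.
have h2 := ler_wpM2l (ltW eps_gt0) xy'.
have [h3 _] := p_close _ _ Ex0 Ex xx0.
have := le_trans (enorm_coord _ i) (h3 (y - y')).
have := aff_proj_lip x y y' Ex => /rowP/(_ i).
have := aff_proj_lip x0 y y' Ex0 => /rowP/(_ i).
rewrite !coordB ler_norml => E1 E2 /andP[h4 h5]; lra.
Qed.

End Near.

Lemma glued_proj_close x0 y : E x0 -> enorm (y - x0) <= 6 * r ->
  enorm (glued_proj y - aff_proj x0 y) <= n%:R * (200 * eps * r).
Proof.
move=> Ex0 yx0; apply: enorm_le_coord => i; rewrite coordB.
have er0 : 0 <= eps * r by rewrite mulr_ge0 // ltW.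
have h1 := glued_proj_le_center _ i Ex0 _ yx0.
have h2 : aff_proj x0 y 0 i - 200 * eps * r <= glued_proj y 0 i.
  apply: (glued_proj_ge x0) => // x Ex xy.
  have := glued_term_ge _ i Ex0 _ _ yx0 Ex xy.
  by have := glued_penalty_ge0 x y; lra.
by rewrite ler_norml; lra.
Qed.

Lemma glued_proj_lip x0 y y' : E x0 ->
  enorm (y - x0) <= 6 * r -> enorm (y' - x0) <= 6 * r ->
  enorm ((glued_proj y - aff_proj x0 y) - (glued_proj y' - aff_proj x0 y'))
    <= n%:R * (28 * eps * enorm (y - y')).
Proof.
move=> Ex0 yx0 yx0'; apply: enorm_le_coord => i.
have h1 := glued_proj_lip_coord _ i Ex0 _ _ yx0 yx0'.
have h2 := glued_proj_lip_coord _ i Ex0 _ _ yx0' yx0.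
rewrite (enorm_distC y') in h2.
by rewrite !coordB ler_norml; lra.
Qed.

(** The invariant of the induction on scales. The radius 20 covers the points within [10 * s] of E
    with room to spare, and at the next scale it is only twice the present one. *)
Definition flat_near (S : set 'rV[R]_n) (q : 'rV[R]_n -> 'rV[R]_n -> 'rV[R]_n)
    (alpha s : R) := forall x, E x -> exists G,
  [/\ lip_graph (q x) alpha G, exists z, G z /\ enorm (z - x) <= alpha * s &
      forall z, enorm (z - x) <= 20 * s -> S z <-> G z].

(** * The displacement near the surface, its extension, and the flatness it produces *)

Section Deform.
Variables (S : set 'rV[R]_n) (alpha lam c : R).
Hypotheses (n_gt0 : (0 < n)%N) (S_flat : flat_near S p alpha r).
Hypotheses (alpha_ge0 : 0 <= alpha) (lam_small : lam <= 64^-1).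
Hypotheses (cE : c = 200 * n%:R * eps) (lamE : lam = 16 * n%:R * (c + 7 * alpha)).

(** The displacement [h] is prescribed only on [near] and [far]. The gap of width [r] between them
    plays the role of the transition zone of a cutoff function. *)
Let near y := S y /\ exists2 x, E x & enorm (y - x) <= 5 * r.
Let far y := forall x, E x -> 6 * r <= enorm (y - x).
Let h y := if `[< far y >] then 0 else glued_proj y - y.

Let n_ge1 : 1 <= n%:R :> R. Proof. by rewrite ler1n. Qed.

Let c_ge0 : 0 <= c. Proof. by rewrite cE mulr_ge0 ?mulr_ge0 ?ler0n // ltW. Qed.

Let c_alpha_le_lam : 16 * (c + 7 * alpha) <= lam.
Proof.
have h0 : 0 <= c + 7 * alpha by have := c_ge0; have := alpha_ge0; lra.
by have := ler_wpM2r h0 n_ge1; rewrite lamE; lra.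
Qed.

Let h_far y : far y -> h y = 0.
Proof. by move=> fy; rewrite /h; case: asboolP. Qed.

Let h_near y x : E x -> enorm (y - x) <= 5 * r -> h y = glued_proj y - y.
Proof.
move=> Ex yx; rewrite /h; case: asboolP => // /(_ _ Ex).
by have := r_gt0; move=> *; exfalso; lra.
Qed.

Let h_near_lip x y y' : E x -> S y -> S y' ->
  enorm (y - x) <= 5 * r -> enorm (y' - x) <= 6 * r ->
  enorm ((glued_proj y - y) - (glued_proj y' - y')) <= (c + alpha) * enorm (y - y').
Proof.
move=> Ex Sy Sy' yx yx'; have [G [gG _ SG]] := S_flat _ Ex.
have Gy : G y by apply/SG => //; have := r_gt0; lra.
have Gy' : G y' by apply/SG => //; have := r_gt0; lra.
have -> : (glued_proj y - y) - (glued_proj y' - y') =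
    ((glued_proj y - aff_proj x y) - (glued_proj y' - aff_proj x y'))
    - ((y - y') - p x (y - y')).
  by rewrite -(aff_proj_lip _ _ _ Ex); move: (aff_proj x y) (aff_proj x y') => *; vring.
apply: le_trans (enormB _ _) _; have := gG.1 _ _ Gy Gy'.
have y6 : enorm (y - x) <= 6 * r by have := r_gt0; lra.
have := glued_proj_lip _ _ _ Ex y6 yx'.
have : 0 <= n%:R * eps * enorm (y - y').
  by rewrite mulr_ge0 ?enorm_ge0 // mulr_ge0 // ltW.
by rewrite mulrDl cE; lra.
Qed.

(** The glued projection is within [c * r] of [aff_proj x]. The distance from [y] to the plane is at
    most [6 * alpha * r] for the chord from [z0] plus [alpha * r] for the offset of [z0], whence the
    7. *)
Let h_near_size y : near y -> enorm (h y) <= (c + 7 * alpha) * r.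
Proof.
move=> [Sy [x Ex yx]]; rewrite (h_near _ _ Ex yx).
have [G [gG [z0 [Gz0 z0x]] SG]] := S_flat _ Ex.
have Gy : G y by apply/SG => //; have := r_gt0; lra.
have op := p_proj _ Ex.
have -> : glued_proj y - y = (glued_proj y - aff_proj x y)
    - (((y - z0) - p x (y - z0)) + ((z0 - x) - p x (z0 - x))).
  have e : p x (y - z0) + p x (z0 - x) = p x (y - x).
    by rewrite -(orth_projD (p x)) // addrA subrK.
  rewrite /aff_proj -e.
  by move: (p x (y - z0)) (p x (z0 - x)) (glued_proj y) => *; vring.
apply: le_trans (enormB _ _) _.
have := enormD ((y - z0) - p x (y - z0)) ((z0 - x) - p x (z0 - x)).
have := enorm_coproj _ (z0 - x) op; have := gG.1 _ _ Gy Gz0.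
have y6 : enorm (y - x) <= 6 * r by have := r_gt0; lra.
have := glued_proj_close _ _ Ex y6.
have a1 : alpha * r <= r.
  rewrite ler_piMl ?(ltW r_gt0) //.
  by have := c_alpha_le_lam; have := c_ge0; have := lam_small; have := alpha_ge0; lra.
have yz0 : enorm (y - z0) <= 6 * r.
  by have := enorm_dist_tri x y z0; rewrite (enorm_distC x); lra.
have := ler_wpM2l alpha_ge0 yz0.
by rewrite mulrDl cE; lra.
Qed.

(** On its domain [h] is [2 * M]-Lipschitz: pairs at distance more than [r], and mixed pairs, are
    settled by the size of [h] alone, and close pairs by a common centre [x]. The extension has
    constant [n * (2 * M) = lam / 8]. The slack of 8 pays for the size bound: a point that is not
    far lies within [7 * r] of a near one, where [H] is at most [M * r]. *)
Lemma deformation_extension : exists H : 'rV[R]_n -> 'rV[R]_n,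
  [/\ forall y y', enorm (H y - H y') <= lam * enorm (y - y'),
      forall y, enorm (H y) <= lam * r,
      forall y, far y -> H y = 0 &
      forall y, near y -> H y = glued_proj y - y].
Proof.
set M := c + 7 * alpha.
have M0 : 0 <= M by have := c_ge0; have := alpha_ge0; rewrite /M; lra.
have mixed y y' : near y -> far y' -> enorm (h y) <= M * enorm (y - y').
  move=> ny fy'; apply: le_trans (h_near_size _ ny) _.
  case: ny => Sy [x Ex yx]; rewrite ler_wpM2l //.
  by have := fy' _ Ex; have := enorm_dist_tri y y' x; rewrite (enorm_distC y' y); lra.
have hL y y' : near y \/ far y -> near y' \/ far y' ->
    enorm (h y - h y') <= 2 * M * enorm (y - y').
  have t0 : 0 <= M * enorm (y - y') by rewrite mulr_ge0 ?enorm_ge0.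
  case=> [ny|fy]; case=> [ny'|fy'].
  - have [yy'|yy'] := leP (enorm (y - y')) r.
      have [Sy [x Ex yx]] := ny; have [Sy' [x' Ex' yx']] := ny'.
      rewrite (h_near _ _ Ex yx) (h_near _ _ Ex' yx').
      have y'x : enorm (y' - x) <= 6 * r.
        by have := enorm_dist_tri y y' x; rewrite (enorm_distC y' y); lra.
      apply: le_trans (h_near_lip _ _ _ Ex Sy Sy' yx y'x) _.
      rewrite ler_wpM2r ?enorm_ge0 //.
      by have := c_ge0; have := alpha_ge0; rewrite /M; lra.
    apply: le_trans (enormB _ _) _.
    have := h_near_size _ ny; have := h_near_size _ ny'; rewrite -/M.
    by have := ler_wpM2l M0 (ltW yy'); lra.
  - by rewrite (h_far _ fy') subr0; have := mixed _ _ ny fy'; lra.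
  - rewrite (h_far _ fy) sub0r enormN enorm_distC.
    by rewrite (enorm_distC y) in t0 *; have := mixed _ _ ny' fy; lra.
  - by rewrite !h_far // subrr enorm0; lra.
have M20 : 0 <= 2 * M by lra.
have [H [HE HL]] := mcshane [set y | near y \/ far y] h _ M20 hL.
have lamM : n%:R * (2 * M) = lam / 8 by rewrite lamE -/M; lra.
have Hfar y : far y -> H y = 0 by move=> fy; rewrite HE ?h_far //; right.
rewrite lamM in HL; have Mlam := c_alpha_le_lam; rewrite -/M in Mlam.
have r0 := r_gt0.
have lr0 : 0 <= lam * r by rewrite mulr_ge0 ?(ltW r_gt0) //; lra.
have Mr : 16 * (M * r) <= lam * r by rewrite mulrA ler_pM2r.
exists H; split=> // [y y'|y|y ny].
- have : 0 <= lam * enorm (y - y') by rewrite mulr_ge0 ?enorm_ge0 //; lra.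
  by have := HL y y'; lra.
- have [fy|nfy] := pselect (far y); first by rewrite Hfar // enorm0.
  have [x [Ex yx]] : exists x, E x /\ enorm (y - x) < 6 * r.
    apply: contrapT => ne; apply: nfy => x Ex; rewrite leNgt.
    by apply/negP => yx; apply: ne; exists x.
  have [G [gG [z [Gz zx]] SG]] := S_flat _ Ex.
  have a1 : alpha * r <= r.
    rewrite ler_piMl ?(ltW r_gt0) //; move: Mlam; rewrite /M.
    by have := c_ge0; have := lam_small; have := alpha_ge0; lra.
  have Sz : S z by apply/SG => //; lra.
  have nz : near z by split=> //; exists x => //; lra.
  have Hz : enorm (H z) <= M * r by rewrite HE; [exact: h_near_size|left].
  have yz : enorm (y - z) <= 7 * r.
    by have := enorm_dist_tri x y z; rewrite (enorm_distC x); lra.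
  have l8 : 0 <= lam / 8 by lra.
  have := HL y z; have := ler_wpM2l l8 yz.
  by have := enormD (H y - H z) (H z); rewrite subrK; lra.
- rewrite HE; last by left.
  by case: ny => _ [x Ex yx]; rewrite (h_near _ _ Ex yx).
Qed.

Local Ltac strip :=
  clear -eps_gt0 r_gt0 p_proj p_close n_gt0 S_flat alpha_ge0 lam_small cE lamE
    n_ge1 c_ge0 c_alpha_le_lam h_far h_near h_near_lip h_near_size.

(** The crude slope [2 * (alpha + lam)] of the image serves only to reach the threshold 1/4 of
    [lip_graph_localize], which replaces it by [4 * n * c] near [x]. Tilting to [p'] adds [8 * eps],
    and the total stays below [alpha]. Localizing at radius [4 * r] gives agreement up to
    [2 * r = 20 * s]. *)
Lemma deform (p' : 'rV[R]_n -> 'rV[R]_n -> 'rV[R]_n) s : r = 10 * s ->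
  (forall x, E x -> orth_proj (p' x)) ->
  (forall x u, E x -> enorm (p x u - p' x u) <= 8 * eps * enorm u) ->
  alpha = 2000 * n%:R ^+ 2 * eps ->
  exists sigma, [/\ near_id lam sigma,
    forall y, enorm (sigma y - y) <= lam * r,
    forall y, (forall x, E x -> 6 * r <= enorm (y - x)) -> sigma y = y &
    flat_near (sigma @` S) p' alpha s].
Proof.
move=> rs op' pp' alphaE.
have [H [HL Hsize Hfar Hnear]] := deformation_extension.
pose sigma y := y + H y.
have sH y : sigma y - y = H y by rewrite /sigma addrC addKr.
have sid : near_id lam sigma by move=> y y'; rewrite !sH.
have ssize y : enorm (sigma y - y) <= lam * r by rewrite sH.
have snear y : near y -> sigma y = glued_proj y.
  by move=> ny; rewrite /sigma Hnear // addrC subrK.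
exists sigma; split=> // [y fy|x Ex]; first by rewrite /sigma Hfar ?addr0.
have clam := c_alpha_le_lam; have c0 := c_ge0.
have r0 := r_gt0; have l0 := lam_small; have al0 := alpha_ge0.
have [G [gG [z0 [Gz0 z0x]] SG]] := S_flat _ Ex; have op := p_proj _ Ex.
have lr : lam * r <= 64^-1 * r by rewrite ler_pM2r.
have ar : alpha * r <= 16^-1 * r by rewrite ler_pM2r //; lra.
have cr : c * r <= 16^-1 * r by rewrite ler_pM2r //; lra.
have a2 : alpha <= 2^-1 by lra.
have gG' : lip_graph (p x) (2 * (alpha + lam)) (sigma @` G).
  by apply: lip_graph_image => //; move: clam al0 c0 l0; strip => *; apply/andP; split; lra.
have near_of y : G y -> enorm (y - x) <= 5 * r -> near y.
  by move=> Gy yx; split; [apply/SG => //; lra|exists x].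
(* For the point of [G] above [x] one has [aff_proj x y = x], so its image lies within [c * r] of
   [x], whatever [alpha] is. *)
have [y [Gy yp]] := gG.2 x.
have yx : enorm (y - x) <= r.
  have := lip_graph_dist op a2 gG Gy Gz0; rewrite yp -(orth_projB (p x)) //.
  have := enorm_proj _ (x - z0) op; rewrite (enorm_distC x).
  by have := enorm_dist_tri z0 y x; lra.
have syx : enorm (sigma y - x) <= c * r.
  rewrite snear; last by apply: near_of => //; lra.
  have -> : glued_proj y - x = glued_proj y - aff_proj x y.
    by rewrite /aff_proj (orth_projB (p x)) // yp subrr addr0.
  have y6 : enorm (y - x) <= 6 * r by lra.
  by have := glued_proj_close _ _ Ex y6; rewrite cE; strip; lra.
have hloc z z' : (sigma @` G) z -> (sigma @` G) z' ->
    enorm (z - x) <= 4 * r -> enorm (z' - x) <= 4 * r ->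
    enorm ((z - z') - p x (z - z')) <= 2 * c * enorm (z - z').
  move=> [w Gw <-] [w' Gw' <-] wx w'x.
  have w5 : enorm (w - x) <= 5 * r.
    have := enorm_dist_tri (sigma w) w x; have := ssize w.
    by rewrite (enorm_distC w (sigma w)); move: lr r0 wx; strip; lra.
  have w'5 : enorm (w' - x) <= 5 * r.
    have := enorm_dist_tri (sigma w') w' x; have := ssize w'.
    by rewrite (enorm_distC w' (sigma w')); move: lr r0 w'x; strip; lra.
  have dw : enorm (w - w') <= 2 * enorm (sigma w - sigma w').
    have := near_id_ge w w' sid; have := ler_wpM2r (enorm_ge0 (w - w')) lam_small.
    by have := enorm_ge0 (w - w'); strip; lra.
  have w6 : enorm (w - x) <= 6 * r by move: w5 r0; strip; lra.
  have w'6 : enorm (w' - x) <= 6 * r by move: w'5 r0; strip; lra.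
  have := glued_proj_lip _ _ _ Ex w6 w'6.
  rewrite -(snear w (near_of w Gw w5)) -(snear w' (near_of w' Gw' w'5)).
  set e := (_ - _) - (_ - _).
  (* The image chord is [e] plus a vector in the range of [p x], so its vertical part is that of
     [e], which is bounded in terms of [eps] alone: the old slope drops out. *)
  have -> : sigma w - sigma w' - p x (sigma w - sigma w') = e - p x e.
    have -> : e = (sigma w - sigma w') - p x (w - w').
      rewrite -(aff_proj_lip _ _ _ Ex) /e.
      by move: (aff_proj x w) (aff_proj x w') (sigma w) (sigma w') => *; vring.
    rewrite (orth_projB (p x) (sigma w - sigma w')) // (orth_projK (p x)) //.
    by move: (sigma w) (sigma w') => a b; vring.
  have := enorm_coproj _ e op; have := ler_wpM2l c0 dw.
  have : 0 <= n%:R * eps * enorm (w - w').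
    by rewrite mulr_ge0 ?enorm_ge0 // mulr_ge0 // ltW.
  by rewrite cE; strip; lra.
have sy8 : enorm (sigma y - x) <= (4 * r) / 8 by move: syx cr r0; strip; lra.
have a04 : 0 <= 2 * (alpha + lam) <= 4^-1.
  by move: clam al0 c0 l0; strip => *; apply/andP; split; lra.
have c20 : 0 <= 2 * c by rewrite mulr_ge0.
have Gsy : (sigma @` G) (sigma y) by exists y.
have [G' [gG'' GG']] := lip_graph_localize (2 * c) _ _ op a04 c20 gG' Gsy sy8 hloc.
have n1 := n_ge1.
have nc : 16 * (n%:R * c) <= lam.
  by rewrite lamE; have := mulr_ge0 (ler0n R n) alpha_ge0; strip; lra.
have ec : 200 * eps <= c by rewrite cE; have := ler_wpM2r (ltW eps_gt0) n1; strip; lra.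
have nn : eps <= n%:R * eps by rewrite ler_peMl // ltW.
have nn2 : n%:R * eps <= n%:R ^+ 2 * eps.
  by rewrite ler_wpM2r ?(ltW eps_gt0) // expr2 ler_peMl.
have s0 : 0 < s by move: rs r0; strip; lra.
exists G'; split.
- apply: (@lip_graph_weaken _ _ _ (2 * n%:R * (2 * c) + 8 * eps)).
    by rewrite alphaE cE; move: nn nn2 eps_gt0; strip; lra.
  apply: (lip_graph_tilt (8 * eps) op (op' _ Ex) _ _ (fun u => pp' x u Ex) gG'').
    by move: nc clam al0 c0 l0; strip; lra.
  by move: ec clam al0 c0 l0; strip; lra.
(* In terms of the new scale, [c * r] is [10 * c * s]; this is where the 2000 in [alpha] comes
   from. *)
- exists (sigma y); split; first by apply/GG' => //; move: syx cr r0; strip; lra.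
  apply: le_trans syx _; rewrite rs mulrA ler_pM2r // cE alphaE.
  by move: nn2 nn eps_gt0; strip; lra.
- move=> z zx; rewrite -GG'; last by move: zx rs r0; strip; lra.
  have loc w : enorm (sigma w - x) <= 20 * s -> enorm (w - x) <= 20 * r.
    have := enorm_dist_tri (sigma w) w x; have := ssize w.
    by rewrite (enorm_distC w (sigma w)); move: lr rs r0; strip; lra.
  by split=> -[w Hw wz]; exists w => //; apply/SG => //; apply: loc; rewrite wz.
Qed.

End Deform.
End OneScale.

(** * The limit surface *)

Section LocalFlatness.
Context {R : realType} {n : nat}.
Implicit Types (u v w x y z : 'rV[R]_n).

(** The plane is put through [x] although the graph only passes through the nearby [x1]; this offset
    and the distance between [S] and [G] each cost [tau]. The point of [G] above a point of the
    plane may be [2 * r] away from [x1], hence the larger radius in the second approximation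
    hypothesis. *)
Lemma local_hausdorff_near_graph x x1 (S G : set 'rV[R]_n) V p (r tau delta eta : R) :
  0 < r -> 0 <= delta <= 2^-1 -> orth_proj_on V p -> lip_graph p delta G ->
  G x1 -> enorm (x1 - x) <= tau ->
  (forall y, S y -> enorm (y - x) <= r -> exists z, G z /\ enorm (y - z) <= tau) ->
  (forall z, G z -> enorm (z - x) <= 2 * r + tau ->
    exists y, S y /\ enorm (y - z) <= tau) ->
  2 * delta * (r + tau) + 2 * tau <= eta * r ->
  (local_hausdorff x r S (plane x V) <= eta%:E)%E.
Proof.
move=> r0 /andP[d0 d2] oV gG Gx1 x1x SG GS etaE; have [op pV] := oV.
have tau0 : 0 <= tau by apply: le_trans x1x; exact: enorm_ge0.
have dt0 : 0 <= delta * tau by rewrite mulr_ge0.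
have dr0 : 0 <= delta * r by rewrite mulr_ge0 // ltW.
apply/local_hausdorff_le => //; split=> y.
- move=> Sy yx; have [z [Gz yz]] := SG y Sy yx.
  apply: (dist_set_le_enorm _ (x + p (y - x))).
    by rewrite /plane /= addrC addKr (orth_proj_mem _ _ _ oV).
  have -> : y - (x + p (y - x)) = ((z - x1) - p (z - x1)) +
      (((y - z) + (x1 - x)) - p ((y - z) + (x1 - x))).
    have -> : y - x = (z - x1) + ((y - z) + (x1 - x)) by vring.
    rewrite (orth_projD p (z - x1)) //.
    by move: (p (z - x1)) (p _) => *; vring.
  apply: le_trans (enormD _ _) _.
  have := enorm_coproj p ((y - z) + (x1 - x)) op.
  have := enormD (y - z) (x1 - x); have := gG.1 _ _ Gz Gx1.
  have zx1 : enorm (z - x1) <= r + 2 * tau.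
    have := enorm_dist_tri y z x1; have := enorm_dist_tri x y x1.
    by rewrite (enorm_distC z y) (enorm_distC x x1); lra.
  by have := ler_wpM2l d0 zx1; lra.
- rewrite /plane /= => yV yx; have pv : p (y - x) = y - x by apply/pV.
  have [z [Gz zp]] := gG.2 (x1 + (y - x)).
  have pzx : p (z - x1) = y - x.
    by rewrite (orth_projB p) // zp (orth_projD p) // pv addrC addKr.
  have zx1 : enorm (z - x1) <= 2 * r.
    have := lip_graph_dist op d2 gG Gz Gx1.
    by rewrite -(orth_projB p) // pzx; lra.
  have [|s [Ss sz]] := GS z Gz.
    by have := enorm_dist_tri x1 z x; lra.
  apply: (dist_set_le_enorm _ s) => //.
  have -> : y - s = ((z - s) - (x1 - x)) - ((z - x1) - p (z - x1)).
    by rewrite pzx; vring.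
  apply: le_trans (enormB _ _) _.
  have := enormB (z - s) (x1 - x); have := gG.1 _ _ Gz Gx1.
  by rewrite (enorm_distC z s); have := ler_wpM2l d0 zx1; lra.
Qed.

End LocalFlatness.

Section Parametrization.
Context {R : realType} {n : nat}.
Implicit Types (u v w x y z : 'rV[R]_n).
Variables (d : nat) (E Sigma0 : set 'rV[R]_n) (PS : 'rV[R]_n -> set 'rV[R]_n).
Variables (V : nat -> 'rV[R]_n -> {vspace 'rV[R]_n}).
Variables (pr : nat -> 'rV[R]_n -> 'rV[R]_n -> 'rV[R]_n) (eps c alpha lam : R).
Local Notation N := (n%:R : R).
Local Notation r := (scale10 R).
Hypotheses (n_gt0 : (0 < n)%N) (eps_gt0 : 0 < eps).
Hypotheses (cE : c = 200 * N * eps) (alphaE : alpha = 2000 * N ^+ 2 * eps).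
Hypotheses (lamE : lam = 16 * N * (c + 7 * alpha)) (lam_small : N * lam <= 200^-1).
Hypothesis Sigma0_flat : flat_model_surface d eps Sigma0 PS.
Hypothesis V_dim : forall k x, E x -> \dim (V k x) = d.
Hypothesis V_pr : forall k x, E x -> orth_proj_on (V k x) (pr k x).
Hypothesis pr_close : forall k x x', E x -> E x' -> enorm (x' - x) <= 50 * r k ->
  (forall u, enorm (pr k x u - pr k x' u) <= 8 * eps * enorm u) /\
  enorm ((x - x') - pr k x' (x - x')) <= 100 * eps * r k.
Hypothesis pr_next : forall k x u, E x ->
  enorm (pr k x u - pr k.+1 x u) <= 8 * eps * enorm u.
Hypothesis start : flat_near E Sigma0 (pr 0%N) alpha 1.

Let N_ge1 : 1 <= N. Proof. by rewrite ler1n. Qed.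

Let eps_le_alpha : eps <= alpha.
Proof.
have h1 : N <= N ^+ 2 by rewrite expr2 ler_peMl //; have := N_ge1; lra.
by rewrite alphaE ler_peMl ?ltW //; have := N_ge1; lra.
Qed.

Let alpha_le_lam : 112 * alpha <= lam.
Proof.
have c0 : 0 <= c by rewrite cE mulr_ge0 ?mulr_ge0 ?ler0n // ltW.
have a0 : 0 <= alpha by have := eps_le_alpha; have := eps_gt0; lra.
have h0 : 0 <= c + 7 * alpha by lra.
by have := ler_wpM2r h0 N_ge1; rewrite lamE; lra.
Qed.

Let lam_gt0 : 0 < lam.
Proof. by have := alpha_le_lam; have := eps_le_alpha; have := eps_gt0; lra. Qed.

Let lam_le : lam <= N * lam.
Proof. by rewrite ler_peMl // ltW. Qed.

Lemma deformations_exist : exists sigma : nat -> 'rV[R]_n -> 'rV[R]_n,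
  [/\ forall k, near_id lam (sigma k),
    forall k y, enorm (sigma k y - y) <= lam * r k,
    forall k y, (forall x, E x -> 6 * r k <= enorm (y - x)) -> sigma k y = y &
    forall k, flat_near E (compose_upto sigma k @` Sigma0) (pr k) alpha (r k)].
Proof.
(* A step is chosen for every pair of a scale and a set, with flatness as a premise inside the
   choice. The recursion [T] then carries only sets, and flatness is proved afterwards by
   induction. *)
have /choice[st stP] : forall kS : nat * set 'rV[R]_n, exists sigma,
    flat_near E kS.2 (pr kS.1) alpha (r kS.1) ->
    [/\ near_id lam sigma, forall y, enorm (sigma y - y) <= lam * r kS.1,
      forall y, (forall x, E x -> 6 * r kS.1 <= enorm (y - x)) -> sigma y = y &
      flat_near E (sigma @` kS.2) (pr kS.1.+1) alpha (r kS.1.+1)].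
  move=> [k S] /=; have [fS|nfS] := pselect (flat_near E S (pr k) alpha (r k));
    last by exists id => /nfS.
  have prP j x : E x -> orth_proj (pr j x) by move=> /(V_pr j)[].
  have a0 : 0 <= alpha by have := eps_le_alpha; have := eps_gt0; lra.
  have l64 : lam <= 64^-1 by have := lam_le; have := lam_small; lra.
  have [s [h1 h2 h3 h4]] := deform E (pr k) eps (r k) eps_gt0 (scale10_gt0 k)
    (prP k) (pr_close k) S alpha lam c n_gt0 fS a0 l64 cE lamE (pr k.+1) (r k.+1)
    (scale10S k) (prP k.+1) (pr_next k) alphaE.
  by exists s.
pose T := fix T k := if k is j.+1 then st (j, T j) @` T j else Sigma0.
have TP k : flat_near E (T k) (pr k) alpha (r k).
  elim: k => [|k IH]; first by rewrite scale10_0.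
  by have [] := stP (k, T k) IH.
pose sigma k := st (k, T k); exists sigma.
have TE k : T k = compose_upto sigma k @` Sigma0.
  elim: k => [|k IH]; first by rewrite /= image_id.
  by rewrite [LHS]/= [in X in _ @` X]IH image_comp.
split=> [k|k y|k y|k]; last by rewrite -TE.
- by have [] := stP (k, T k) (TP k).
- by have [_ + _ _] := stP (k, T k) (TP k); apply.
- by have [_ _ + _] := stP (k, T k) (TP k); apply.
Qed.

Variables (sigma : nat -> 'rV[R]_n -> 'rV[R]_n) (g : 'rV[R]_n -> 'rV[R]_n).
Local Notation f := (compose_upto sigma).
Local Notation nu := (2 * N * lam).
Hypothesis sigma_lip : forall k, near_id lam (sigma k).
Hypothesis sigma_disp : forall k y, enorm (sigma k y - y) <= lam * r k.
Hypothesis sigma_far : forall k y,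
  (forall x, E x -> 6 * r k <= enorm (y - x)) -> sigma k y = y.
Hypothesis f_flat : forall k, flat_near E (f k @` Sigma0) (pr k) alpha (r k).
Hypothesis g_f : forall k x, enorm (g x - f k x) <= nu * r k.

Let nu_le : nu <= 100^-1. Proof. by have := lam_small; lra. Qed.

Let nu_r k : nu * r k <= 100^-1 * r k.
Proof. by rewrite ler_pM2r ?scale10_gt0 ?nu_le. Qed.

Lemma limit_far k x : (forall e, E e -> 6 * r k <= enorm (f k x - e)) ->
  g x = f k x.
Proof.
move=> farx; have fx j : f (k + j)%N x = f k x.
  elim: j => [|j IH]; first by rewrite addn0.
  rewrite addnS /= IH; apply: sigma_far => e Ee.
  apply: le_trans (farx e Ee); rewrite ler_pM2l //; apply: scale10_le.
  exact: leq_addr.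
apply/eqP; rewrite -subr_eq0; apply/eqP/enorm0_eq0.
have q10 : 0 <= (10^-1 : R) <= 2^-1 by lra.
apply: (@le_geometric_le0 _ _ nu _ q10) => j; rewrite -scale10E -(fx j).
apply: le_trans (g_f (k + j)%N x) _; rewrite ler_pM2l.
  by apply: scale10_le; exact: leq_addl.
by have := lam_le; have := lam_gt0; lra.
Qed.

(** Let [y] be the preimage of [x]. At each stage some [s k] in [Sigma0] and [y] itself both land
    within a fraction of 10^-k of [x]; pulling back gives [enorm (y - s k) <= 5^-k]. Near [s 0] the
    model surface is a Lipschitz graph, hence closed, and contains [y]. *)
Lemma limit_covers : (forall y, exists x, g x = y) -> E `<=` g @` Sigma0.
Proof.
move=> gsurj x Ex; have [y gy] := gsurj x; exists y => //.
have /choice[s sP] : forall k, exists s, Sigma0 s /\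
    enorm (f k s - x) <= alpha * r k.
  move=> k; have [G [_ [z [Gz zx]] SG]] := f_flat k _ Ex.
  have r0 := @scale10_gt0 R k.
  have ar : alpha * r k <= 1 * r k.
    by rewrite ler_pM2r //; have := alpha_le_lam; have := lam_le;
      have := lam_small; have := lam_gt0; lra.
  have [s Ss sz] : (f k @` Sigma0) z by apply/SG => //; lra.
  by exists s; rewrite sz.
have ys k : enorm (y - s k) <= 1 * 5^-1 ^+ k.
  have lam32 : lam <= 32^-1 by have := lam_le; have := lam_small; lra.
  have h := compose_upto_ge sigma lam lam32 sigma_lip k y (s k).
  have h1 := g_f k y; rewrite gy enorm_distC in h1.
  have h2 := enorm_dist_tri x (f k y) (f k (s k)).
  rewrite (enorm_distC x) in h2; have h3 := (sP k).2.
  have r0 := @scale10_gt0 R k.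
  have h4 : alpha * r k <= 2^-1 * r k.
    by rewrite ler_pM2r //; have := alpha_le_lam; have := lam_gt0; lra.
  have h5 : (1 - lam) ^+ k * enorm (y - s k) <= r k.
    by have := nu_r k; lra.
  have l2 : 2^-1 ^+ k <= (1 - lam) ^+ k.
    by rewrite lerXn2r ?nnegrE //; lra.
  have := le_trans (ler_wpM2r (enorm_ge0 (y - s k)) l2) h5.
  rewrite scale10E mul1r; have -> : (10^-1 : R) = 2^-1 * 5^-1 by lra.
  by rewrite exprMn ler_pM2l // exprn_gt0.
have ys1 k : enorm (y - s k) <= 1.
  by apply: le_trans (ys k) _; rewrite mul1r exprn_ile1 //; lra.
have [W [p [G [_ _ [op _] gG SG]]]] := flat_model_lip_graph Sigma0_flat (sP 0%N).1.
apply/SG; first by have := ys1 0%N; lra.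
apply: (lip_graph_closed _ _ _ _ op _ gG) => [|e e0].
  by have := eps_le_alpha; have := alpha_le_lam; have := lam_le;
    have := lam_small; have := lam_gt0; lra.
have [k ke] : exists k, enorm (y - s k) <= e.
  apply: contrapT => nk.
  suff : e <= 0 by rewrite leNgt e0.
  have q5 : 0 <= (5^-1 : R) <= 2^-1 by lra.
  apply: (@le_geometric_le0 _ e 1 _ q5) => k; apply: le_trans (ys k).
  by apply: ltW; rewrite ltNge; apply/negP => ke; apply: nk; exists k.
exists (s k); split=> //; apply/SG; last exact: (sP k).1.
have := enorm_dist_tri y (s k) (s 0%N); have := ys1 0%N; have := ys1 k.
by rewrite (enorm_distC y (s k)); lra.
Qed.

Local Notation S := (g @` Sigma0).

(** Points within [2 * r k] of [x], even after an error [nu * r k], remain [6 * r k] away from E, so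
    no later map moves them. *)
Lemma limit_eq_stage k x z : S x ->
  (forall e, E e -> 10 * r k < enorm (x - e)) -> enorm (z - x) <= 2 * r k ->
  S z <-> (f k @` Sigma0) z.
Proof.
move=> Sx xfar zx; have r0 := @scale10_gt0 R k.
have zfar w : enorm (w - z) <= nu * r k -> forall e, E e -> 6 * r k <= enorm (w - e).
  move=> wz e Ee; have := xfar e Ee; have := enorm_dist_tri z x e.
  have := enorm_dist_tri w z e; have := nu_r k.
  by rewrite (enorm_distC x z) (enorm_distC z w); lra.
split=> -[z0 Sz0 zE]; exists z0 => //.
  rewrite -zE (limit_far k) //; apply: zfar.
  by rewrite -zE enorm_distC; apply: g_f.
rewrite (limit_far k) //; apply: zfar; rewrite zE subrr enorm0.
by rewrite mulr_ge0 ?(ltW r0) //; have := lam_le; have := lam_gt0; lra.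
Qed.

(** Go back to the first scale at which [x] is far from E. At scale 0 the model surface itself is a
    graph. Otherwise some [e] in E was within 10 radii one scale earlier, so that stage was a graph
    near [e], and a single map [sigma k] separates it from the limit. *)
Lemma limit_graph_away k x : S x ->
  (forall e, E e -> 10 * r k < enorm (x - e)) ->
  exists W p G, [/\ \dim W = d, orth_proj_on W p, lip_graph p (2 * (alpha + lam)) G &
    forall z, enorm (z - x) <= 2 * r k -> S z <-> G z].
Proof.
move=> Sx; elim: k => [|k IH] xfar.
  have f0 : f 0 @` Sigma0 = Sigma0 by exact: image_id.
  have Sigma_x : Sigma0 x.
    rewrite -f0; apply/(limit_eq_stage 0%N x) => //.
    by rewrite subrr enorm0 scale10_0.
  have [W [p [G [dW _ oW gG SG]]]] := flat_model_lip_graph Sigma0_flat Sigma_x.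
  exists W, p, G; split=> //.
    apply: lip_graph_weaken gG.
    by have := eps_le_alpha; have := lam_gt0; have := eps_gt0; lra.
  move=> z zx; rewrite (limit_eq_stage 0%N x) // f0.
  by apply: SG; move: zx; rewrite scale10_0; lra.
have [[e [Ee xe]]|ne] := pselect (exists e, E e /\ enorm (x - e) <= 10 * r k);
    last first.
  have [|W [p [G [dW oW gG SG]]]] := IH.
    by move=> e Ee; rewrite ltNge; apply/negP => xe; apply: ne; exists e.
  exists W, p, G; split=> // z zx; apply: SG; apply: le_trans zx _.
  by rewrite ler_pM2l //; apply: scale10_le.
have [G [gG _ SG]] := f_flat k _ Ee.
have r0 := @scale10_gt0 R k; have rS := @scale10S R k.
have lN := lam_le; have lS := lam_small; have l0 := lam_gt0; have al := alpha_le_lam.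
have a0 : 0 <= alpha by have := eps_le_alpha; have := eps_gt0; lra.
exists (V k e), (pr k e), (sigma k @` G); split.
- exact: V_dim.
- exact: V_pr.
- apply: lip_graph_image => //; [by case: (V_pr k _ Ee)| |];
    by apply/andP; split; lra.
have fS : f k.+1 @` Sigma0 = sigma k @` (f k @` Sigma0) by rewrite image_comp.
move=> z zx; rewrite (limit_eq_stage k.+1 x) // fS.
have ez w : sigma k w = z -> enorm (w - e) <= 20 * r k.
  move=> wz; have := sigma_disp k w; rewrite wz => h.
  have := enorm_dist_tri x z e; have := enorm_dist_tri z w e.
  have lr : lam * r k <= 1 * r k by rewrite ler_pM2r //; lra.
  by rewrite (enorm_distC w z); lra.
by split=> -[w Hw wz]; exists w => //; apply/SG => //; apply: ez.
Qed.

(** With [r k.+1 < rho <= r k], near E the stage [f k] approximates the limit within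
    [tau = nu * r k], at most [10 * nu * rho], and the plane has the direction of P_k(e). Away from
    E the graph is exact and [tau] is 0. The 44 comes from [20 * nu = 40 * (N * lam)] and
    [4 * alpha]. *)
Lemma limit_reifenberg_flat (eta : R) : 44 * (N * lam) <= eta ->
  reifenberg_flat d eta S.
Proof.
move=> etaE x rho Sx /andP[rho0 rho1].
have lN := lam_le; have lS := lam_small; have l0 := lam_gt0; have al := alpha_le_lam.
have a0 : 0 <= alpha by have := eps_le_alpha; have := eps_gt0; lra.
have exk : exists k, r k.+1 < rho.
  apply: contrapT => nk.
  suff : rho <= 0 by rewrite leNgt rho0.
  have q10 : 0 <= (10^-1 : R) <= 2^-1 by lra.
  apply: (@le_geometric_le0 _ rho 1 _ q10) => k; rewrite mul1r -scale10E.
  apply: (@le_trans _ _ (r k.+1)); last exact: scale10_le.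
  by rewrite leNgt; apply/negP => kr; apply: nk; exists k.
have [k kr kmin] := ex_minnP exk.
have rk : rho <= r k.
  case: k kr kmin => [|k] kr kmin; first by rewrite scale10_0.
  by rewrite leNgt; apply/negP => /kmin; rewrite ltnn.
have r0 := @scale10_gt0 R k; have rS := @scale10S R k; have nur := nu_r k.
have [[e [Ee xe]]|ne] := pselect (exists e, E e /\ enorm (x - e) <= 10 * r k).
  have oV := V_pr k _ Ee; have [G [gG _ SG]] := f_flat k _ Ee.
  exists (plane x (V k e)); split; first by exists (V k e); rewrite V_dim.
  have [x0 Sx0 gx0] := Sx; have := g_f k x0; rewrite gx0 => xx0.
  have to_e w : enorm (w - x) <= 5 * r k -> enorm (w - e) <= 20 * r k.
    by have := enorm_dist_tri x w e; lra.
  have Gx0 : G (f k x0).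
    by apply/SG; [apply: to_e; rewrite enorm_distC; lra|exists x0].
  have x0x : enorm (f k x0 - x) <= nu * r k by rewrite enorm_distC.
  apply: (local_hausdorff_near_graph _ _ _ _ _ _ _ (nu * r k) alpha _ rho0
    _ oV gG Gx0 x0x).
  - by apply/andP; split; lra.
  - move=> _ [y0 Sy0 <-] yx; have y0y := g_f k y0.
    exists (f k y0); split=> //; apply/SG; last by exists y0.
    apply: to_e; have := enorm_dist_tri (g y0) (f k y0) x.
    by rewrite (enorm_distC (f k y0) (g y0)); lra.
  - move=> z Gz zx; have [z0 Sz0 zE] : (f k @` Sigma0) z.
      by apply/SG => //; apply: to_e; lra.
    by exists (g z0); split; [exists z0|rewrite -zE; apply: g_f].
  - have nr : nu * r k <= 10 * (nu * rho).
      have nu0 : 0 <= nu by lra.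
      by have := ler_wpM2l nu0 (ltW kr); rewrite rS; lra.
    have h1 : alpha * (rho + nu * r k) <= alpha * (2 * rho).
      by rewrite ler_wpM2l //; lra.
    have h2 : (4 * alpha + 20 * nu) * rho <= eta * rho.
      by rewrite ler_pM2r //; lra.
    by lra.
have [|W [p [G [dW oW gG SG]]]] := limit_graph_away k x Sx.
  by move=> e Ee; rewrite ltNge; apply/negP => xe; apply: ne; exists e.
exists (plane x W); split; first by exists W.
have xx : enorm (x - x) <= 0 by rewrite subrr enorm0.
have Gx : G x by apply/SG => //; lra.
apply: (local_hausdorff_near_graph _ _ _ _ _ _ _ 0 _ _ rho0 _ oW gG Gx xx).
- by apply/andP; split; lra.
- move=> y Sy yx; exists y; rewrite subrr enorm0; split=> //.
  by apply/SG => //; lra.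
- move=> z Gz zx; exists z; rewrite subrr enorm0; split=> //.
  by apply/SG => //; lra.
- rewrite addr0 mulr0 addr0 ler_pM2r //; lra.
Qed.

End Parametrization.

(** Base of the induction: near [x] the surface is the graph attached to a nearby [y] in [Sigma0],
    and the compatibility of P_0(x) with P_y tilts it, with slope [eps + 8 * eps]. *)
Lemma flat_near_start (R : realType) (n d : nat) (eps : R)
    (Sigma0 E : set 'rV[R]_n) (PS P0 : 'rV[R]_n -> set 'rV[R]_n)
    (V : 'rV[R]_n -> {vspace 'rV[R]_n}) (p : 'rV[R]_n -> 'rV[R]_n -> 'rV[R]_n)
    (alpha : R) :
  0 < eps -> eps <= 32^-1 -> 9 * eps <= alpha ->
  flat_model_surface d eps Sigma0 PS ->
  (forall x, E x -> (dist_set x Sigma0 <= eps%:E)%E) ->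
  (forall x, E x -> P0 x = plane x (V x)) ->
  (forall x, E x -> orth_proj_on (V x) (p x)) ->
  (forall x y, E x -> Sigma0 y -> enorm (x - y) <= 2 ->
    (local_hausdorff x 100 (P0 x) (PS y) <= eps%:E)%E) ->
  flat_near E Sigma0 p alpha 1.
Proof.
move=> eps_gt0 eps32 eps_alpha flat dE VP V_pr hP0.
move=> x Ex.
(* The distance is an infimum, so a point is taken within [2 * eps] instead of a nearest one. *)
have [y [Sy xy]] : exists y, Sigma0 y /\ enorm (x - y) <= 2 * eps.
  apply: contrapT => ny.
  have : 2 * eps <= eps.
    apply: (le_of_dist_set _ _ _ _ (dE x Ex)) => y Sy.
    by apply: ltW; rewrite ltNge; apply/negP => xy; apply: ny; exists y.
  by move=> ?; lra.
have [W [q [G [_ PW oW gG SG]]]] := flat_model_lip_graph flat Sy.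
have yx : enorm (y - x) <= 100 / 2 by rewrite enorm_distC; lra.
have xy2 : enorm (x - y) <= 2 by lra.
have := hP0 x y Ex Sy xy2; rewrite VP // PW => h.
have [close _] := local_hausdorff_planes _ _ _ _ _ _ _ _ (ltr0n _ 100)
  (V_pr x Ex) oW yx h.
exists G; split.
- apply: (@lip_graph_weaken _ _ _ (eps + 8 * eps)); first lra.
  apply: (lip_graph_tilt (8 * eps) oW.1 (V_pr x Ex).1 _ _ _ gG); [lra|lra|].
  by move=> u; rewrite enorm_distC.
- exists y; split; first by apply/SG => //; rewrite subrr enorm0 ler0n.
  by rewrite enorm_distC; lra.
- move=> z zx; apply: SG; have := enorm_dist_tri x z y; lra.
Qed.

Theorem theorem12p18 (R : realType) (n d : nat) (hd : (0 < d < n)%N) :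
  exists eps0 C : R, 0 < eps0 /\ 1 <= C /\
    forall (eps : R) (E Sigma0 : set 'rV[R]_n)
      (PS : 'rV[R]_n -> set 'rV[R]_n) (P : nat -> 'rV[R]_n -> set 'rV[R]_n),
      0 < eps <= eps0 ->
      flat_model_surface d eps Sigma0 PS ->
      (forall x, E x -> (dist_set x Sigma0 <= eps%:E)%E) ->
      (forall k x, E x -> dplane_through d x (P k x)) ->
      (forall k x x', E x -> E x' -> enorm (x' - x) <= 100 * scale10 R k ->
        (local_hausdorff x (100 * scale10 R k) (P k x) (P k x') <= eps%:E)%E) ->
      (forall k x, E x ->
        (local_hausdorff x (scale10 R k) (P k x) (P k.+1 x) <= eps%:E)%E) ->
      (forall x y, E x -> Sigma0 y -> enorm (x - y) <= 2 ->
        (local_hausdorff x 100 (P 0%N x) (PS y) <= eps%:E)%E) ->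
      exists g : 'rV[R]_n -> 'rV[R]_n,
        bijective g /\
        (forall x, (12%:E <= dist_set x E)%E -> g x = x) /\
        (forall x, enorm (g x - x) <= C * eps) /\
        (forall x x' : 'rV[R]_n, enorm (x' - x) <= 1 ->
          4^-1 * enorm (x' - x) `^ (1 + C * eps) <= enorm (g x' - g x)
            <= 3 * enorm (x' - x) `^ (1 - C * eps)) /\
        E `<=` g @` Sigma0 /\
        reifenberg_flat d (C * eps) (g @` Sigma0).
Proof.
have [d_gt0 dn] := andP hd; have n_gt0 : (0 < n)%N := ltn_trans d_gt0 dn.
have n1 : 1 <= n%:R :> R by rewrite ler1n.
have nn : n%:R <= n%:R ^+ 2 :> R by rewrite expr2 ler_peMl.
have [Lam [Lam1 LamE]] : exists Lam : R, 1 <= Lam /\ forall eps : R,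
    16 * n%:R * (200 * n%:R * eps + 7 * (2000 * n%:R ^+ 2 * eps)) = Lam * eps.
  exists (16 * n%:R * (200 * n%:R + 7 * (2000 * n%:R ^+ 2))).
  split=> [|eps]; last by ring.
  rewrite -mulrA; apply: (@le_trans _ _ (16 * (1 * 1))); first lra.
  by rewrite ler_wpM2l // ler_pM //; lra.
have NLam : Lam <= n%:R * Lam by rewrite ler_peMl //; lra.
have q0 : 0 < 200 * (n%:R * Lam) by lra.
(* [lam] equals [Lam * eps] with [Lam] depending only on [n]. The first constant makes [n * lam] at
   most 1/200; the second dominates [2 * lam] in the exponents, [2 * n * lam] in the displacement
   and [44 * n * lam] in the flatness. *)
exists (200 * (n%:R * Lam))^-1, (100 * (n%:R * Lam)); split; first by rewrite invr_gt0.
split=> [|eps E Sigma0 PS P /andP[eps_gt0 eps_le] flat dE dP hP hPk hP0]; first lra.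
have /choice[Vp VpP] : forall kx : nat * 'rV[R]_n,
    exists Vp : {vspace 'rV[R]_n} * ('rV[R]_n -> 'rV[R]_n), E kx.2 ->
      [/\ \dim Vp.1 = d, P kx.1 kx.2 = plane kx.2 Vp.1 & orth_proj_on Vp.1 Vp.2].
  move=> [k x] /=; have [Ex|nEx] := pselect (E x); last by exists (0%VS, id).
  have [W [dW PW]] := dP k x Ex; have [p oW] := orth_proj_vspace W.
  by exists (W, p).
pose V k x := (Vp (k, x)).1; pose pr k x := (Vp (k, x)).2.
have V_dim k x : E x -> \dim (V k x) = d by move=> /(VpP (k, x))[].
have VP k x : E x -> P k x = plane x (V k x) by move=> /(VpP (k, x))[].
have V_pr k x : E x -> orth_proj_on (V k x) (pr k x) by move=> /(VpP (k, x))[].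
have pr_close k x x' : E x -> E x' -> enorm (x' - x) <= 50 * scale10 R k ->
    (forall u, enorm (pr k x u - pr k x' u) <= 8 * eps * enorm u) /\
    enorm ((x - x') - pr k x' (x - x')) <= 100 * eps * scale10 R k.
  move=> Ex Ex' xx'; have r0 := @scale10_gt0 R k.
  have r100 : 0 < 100 * scale10 R k by lra.
  have xx100 : enorm (x' - x) <= 100 * scale10 R k by clear -xx' r0; lra.
  have xx50 : enorm (x' - x) <= 100 * scale10 R k / 2 by clear -xx'; lra.
  have := hP k x x' Ex Ex' xx100; rewrite !VP // => h.
  have [h1 h2] := local_hausdorff_planes _ _ _ _ _ _ _ _ r100 (V_pr k x Ex)
    (V_pr k x' Ex') xx50 h.
  by split=> //; clear -h2; lra.
have pr_next k x u : E x ->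
    enorm (pr k x u - pr k.+1 x u) <= 8 * eps * enorm u.
  move=> Ex; have := hPk k x Ex; rewrite !VP // => h.
  have r0 := @scale10_gt0 R k.
  have xx : enorm (x - x) <= scale10 R k / 2 by rewrite subrr enorm0 ltW // divr_gt0.
  by have [] := local_hausdorff_planes _ _ _ _ _ _ _ _ r0 (V_pr k x Ex)
    (V_pr k.+1 x Ex) xx h.
have [c cE] : exists c, c = 200 * n%:R * eps by exists (200 * n%:R * eps).
have [alpha alphaE] : exists a, a = 2000 * n%:R ^+ 2 * eps.
  by exists (2000 * n%:R ^+ 2 * eps).
have [lam lamE0] : exists l, l = 16 * n%:R * (c + 7 * alpha).
  by exists (16 * n%:R * (c + 7 * alpha)).
have lamE : lam = Lam * eps by rewrite lamE0 cE alphaE LamE.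
have NlamE : n%:R * lam = n%:R * Lam * eps by rewrite lamE mulrA.
have eps_inv : n%:R * Lam * eps <= 200^-1.
  have := ler_wpM2l (ltW q0) eps_le; rewrite divff ?gt_eqF //; clear; lra.
have lam_small : n%:R * lam <= 200^-1 by rewrite NlamE.
have lam_le : lam <= n%:R * lam.
  by rewrite ler_peMl // lamE mulr_ge0 // ltW // (lt_le_trans ltr01).
have lam_gt0 : 0 < lam by rewrite lamE mulr_gt0 // (lt_le_trans ltr01).
have eps_alpha : 2000 * eps <= alpha.
  by rewrite alphaE ler_pM2r //; clear -n1 nn; lra.
have eps_lam : eps <= lam by rewrite lamE ler_peMl // ltW.
have start : flat_near E Sigma0 (pr 0%N) alpha 1.
  apply: (@flat_near_start R n d eps Sigma0 E PS (P 0%N) (V 0%N) (pr 0%N) alpha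
    eps_gt0 _ _ flat dE (VP 0%N) (V_pr 0%N) hP0).
    by clear -eps_lam lam_le lam_small; lra.
  by clear -eps_gt0 eps_alpha; lra.
have [sigma [s_lip s_disp s_far s_flat]] := deformations_exist E Sigma0 V pr eps
  c alpha lam n_gt0 eps_gt0 cE alphaE lamE0 lam_small V_pr pr_close pr_next start.
have lam32 : lam <= 32^-1 by clear -lam_le lam_small; lra.
have nlam32 : n%:R * lam <= 32^-1 by clear -lam_small; lra.
have [g [gf gbij]] := compose_limit sigma lam (ltW lam_gt0) nlam32 lam32 s_lip s_disp.
have gsurj y : exists x, g x = y by case: gbij => h _ gh; exists (h y).
exists g; split=> //; split.
  move=> x xE; apply: (limit_far E eps c alpha lam n_gt0 eps_gt0 cE alphaE lamE0
    sigma g s_far gf 0%N) => e Ee; rewrite scale10_0 /=.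
  have : (12%:E <= (enorm (x - e))%:E)%E.
    by apply: le_trans xE _; apply: ereal_inf_lbound; exists e.
  by rewrite lee_fin; clear; lra.
split.
  move=> x; have := gf 0%N x; rewrite scale10_0 /=.
  by clear -NlamE lam_gt0 lam_le; lra.
split; last split.
- move=> x x' xx1.
  have gf16 k y : enorm (g y - compose_upto sigma k y) <= 16^-1 * scale10 R k.
    apply: le_trans (gf k y) _; rewrite ler_pM2r ?scale10_gt0 //.
    by clear -lam_small; lra.
  have /andP[h1 h2] := limit_bi_holder sigma lam (ltW lam_gt0) lam32 s_lip g
    gf16 x x' xx1.
  have Ceps : 2 * lam <= 100 * (n%:R * Lam) * eps.
    by clear -NlamE lam_gt0 lam_le; lra.
  (* For positive distances at most 1, powers decrease with the exponent, so [lam] may be replaced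
     by the larger [C * eps]. Distance 0 is handled apart, as this monotonicity is used for a
     positive base. *)
  have [t0|t0] := leP (enorm (x' - x)) 0.
    have -> : x' = x by apply/eqP; rewrite -subr_eq0; apply/eqP/enorm0_eq0.
    rewrite !subrr enorm0 powR0 ?mulr0; last first.
      by apply/eqP; clear -Ceps lam_gt0; lra.
    by rewrite lexx mulr_ge0 // powR_ge0.
  have t01 : 0 < enorm (x' - x) <= 1 by rewrite t0.
  apply/andP; split.
    by apply: le_trans h1; rewrite ler_wpM2l // ger_powR //; clear -Ceps lam_gt0; lra.
  by apply: le_trans h2 _; rewrite ler_wpM2l // ger_powR //; clear -Ceps lam_gt0; lra.
- exact: (limit_covers d E Sigma0 PS pr eps c alpha lam).
- apply: (limit_reifenberg_flat d E Sigma0 PS V pr eps c alpha lam) => //.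
  by clear -NlamE lam_gt0 lam_le; lra.
Qed.
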